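(* Let $d\ge0$ be an integer. Let $C^*(\mathcal{G},\mathcal{R})$ be the universal $C^*$-algebra generated by the set $$\mathcal{G}=\{1,f_0^{(0)},f_1^{(0)},\dots,f_0^{(d)},f_1^{(d)}\}$$ subject to the relations $\mathcal{R}$: $1$ is a unit and, for all $g,h,k\in\mathbb{Z}_2=\{0,1\}$ with $g\ne h$ and all $j,\ell=0,\dots,d$, $$0\le f_g^{(j)}\le1,\quad [f_g^{(j)},f_k^{(\ell)}]=0,\quad f_g^{(j)}f_h^{(j)}=0,\quad \sum_{g\in\mathbb{Z}_2}\sum_{j=0}^d f_g^{(j)}=1.$$ Define an action $\alpha\colon\mathbb{Z}_2\to\mathrm{Aut}(C^*(\mathcal{G},\mathcal{R}))$ by $\alpha_g(f_h^{(j)})=f_{gh}^{(j)}$ for $g,h\in\mathbb{Z}_2$ and $j=0,\dots,d$, where $gh$ denotes the group operation of $\mathbb{Z}_2$. Then the $\mathbb{Z}_2$-$C^*$-algebra $(C^*(\mathcal{G},\mathcal{R}),\alpha)$ is equivariantly isomorphic, in a canonical way, to $C(S^d)$ with the action induced by the antipodal map of $S^d$.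
   Context: $S^d$ is the $d$-dimensional sphere; the antipodal map is $x\mapsto -x$. *)

(* Defs.v *)
From HB Require Import structures.
From mathcomp Require Import all_boot all_order all_algebra.
From mathcomp Require Import complex lra.
From mathcomp Require Import all_classical all_reals all_analysis.

Set Implicit Arguments.
Unset Strict Implicit.
Unset Printing Implicit Defensive.

Import Order.TTheory GRing.Theory Num.Theory.
Import numFieldNormedType.Exports.

Local Open Scope classical_set_scope.
Local Open Scope ring_scope.

(* Unital C*-algebras.  The algType structure makes 1 <> 0, so the zero algebra
   is left out.  This does not affect universal properties: the zero algebra
   receives exactly one map from any algebra. *)
HB.mixin Record isCStarAlgebra (R : realType) A & GRing.Algebra R[i] A := {
  cnorm : A -> R;
  star : A -> A;
  cnormD : forall a b : A, cnorm (a + b) <= cnorm a + cnorm b;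
  cnormZ : forall (l : R[i]) (a : A),
    cnorm (l *: a) = Normc.normc l * cnorm a;
  cnorm0_eq0 : forall a : A, cnorm a = 0 -> a = 0;
  cnormM : forall a b : A, cnorm (a * b) <= cnorm a * cnorm b;
  cnorm_complete : forall u : nat -> A,
    (forall e : R, 0 < e -> exists N : nat, forall m n : nat,
       (N <= m)%N -> (N <= n)%N -> cnorm (u m - u n) < e) ->
    exists l : A, forall e : R, 0 < e -> exists N : nat, forall n : nat,
      (N <= n)%N -> cnorm (u n - l) < e;
  starD : forall a b : A, star (a + b) = star a + star b;
  starZ : forall (l : R[i]) (a : A), star (l *: a) = l^* *: star a;
  starM : forall a b : A, star (a * b) = star b * star a;
  starK : involutive star;
  cnorm_starM : forall a : A, cnorm (star a * a) = cnorm a ^+ 2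
}.

#[short(type="cstarAlgType")]
HB.structure Definition CStarAlgebra (R : realType) :=
  {A of GRing.Algebra R[i] A & isCStarAlgebra R A}.

Section CStarNotions.
Variable R : realType.

Definition spectrum (A : cstarAlgType R) (a : A) : set R[i] :=
  [set l | ~ exists b : A, b * (a - l%:A) = 1 /\ (a - l%:A) * b = 1].

(* In R[i], 0 <= l means that l is real and nonnegative. *)
Definition cpositive (A : cstarAlgType R) (a : A) : Prop :=
  star a = a /\ forall l : R[i], spectrum a l -> 0 <= l.

Definition cle (A : cstarAlgType R) (a b : A) : Prop := cpositive (b - a).

Definition star_hom (A B : cstarAlgType R) (phi : A -> B) : Prop :=
  [/\ linear phi, monoid_morphism phi
    & {morph phi : a / star a >-> star a}].

Definition star_iso (A B : cstarAlgType R) (phi : A -> B) : Prop :=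
  star_hom phi /\ bijective phi.

(* 'Z_2 is written additively: its group law is +, its neutral element 0. *)
Definition Z2_action (A : cstarAlgType R) (alpha : 'Z_2 -> A -> A) : Prop :=
  [/\ forall g, star_iso (alpha g), alpha 0 =1 id
    & forall g h, alpha (g + h) =1 alpha g \o alpha h].

Definition equivariant (A B : cstarAlgType R) (alpha : 'Z_2 -> A -> A)
    (beta : 'Z_2 -> B -> B) (phi : A -> B) : Prop :=
  forall g a, phi (alpha g a) = beta g (phi a).

(* The generator 1 and the relation that it is a unit are accounted for by
   working with unital algebras and unital morphisms. *)
Section Generators.
Variable d : nat.

Definition relations (A : cstarAlgType R) (f : 'Z_2 -> 'I_d.+1 -> A) : Prop :=
  [/\ forall g j, cle 0 (f g j) /\ cle (f g j) 1,
      forall g k j l, f g j * f k l - f k l * f g j = 0,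
      forall g h j, g != h -> f g j * f h j = 0
    & \sum_(g : 'Z_2) \sum_(j < d.+1) f g j = 1].

Definition universal_for_relations (A : cstarAlgType R)
    (f : 'Z_2 -> 'I_d.+1 -> A) : Prop :=
  relations f /\
  forall (B : cstarAlgType R) (b : 'Z_2 -> 'I_d.+1 -> B), relations b ->
    exists phi : A -> B,
      [/\ star_hom phi, forall g j, phi (f g j) = b g j
        & forall psi : A -> B, star_hom psi ->
            (forall g j, psi (f g j) = b g j) -> psi =1 phi].

Definition generator_action (A : cstarAlgType R) (f : 'Z_2 -> 'I_d.+1 -> A)
    (alpha : 'Z_2 -> A -> A) : Prop :=
  Z2_action alpha /\ forall g h j, alpha g (f h j) = f (g + h) j.

End Generators.
End CStarNotions.

Definition sphere (R : realType) (d : nat) : set 'rV[R]_d.+1 :=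
  [set x | \sum_(j < d.+1) x ord0 j ^+ 2 = 1].
Arguments sphere : clear implicits.

(* set_type carries the topology induced by 'rV[R]_d.+1. *)
Definition Sphere (R : realType) (d : nat) : topologicalType :=
  set_type (sphere R d).

(* R[i]^o carries the topology of the modulus. *)
Definition CSphere (R : realType) (d : nat) : Type :=
  continuousType (Sphere R d) R[i]^o.

Section SphereTopology.
Variables (R : realType) (d : nat).
Local Notation S := (Sphere R d).

Lemma sphereP (x : S) : sphere R d (\val x).
Proof. by case: x => x /= /set_mem. Qed.

Definition to_sphere (x : 'rV[R]_d.+1) (hx : sphere R d x) : S :=
  exist _ x (mem_set hx).

Lemma sphere_nonempty : sphere R d (delta_mx ord0 ord0).
Proof.
rewrite /sphere /= (bigD1 ord0)//= mxE !eqxx /= expr1n big1 ?addr0// => j j0.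
by rewrite mxE eqxx (negbTE j0) /= expr0n.
Qed.

Lemma sphere_opp (x : 'rV[R]_d.+1) : sphere R d x -> sphere R d (- x).
Proof.
by rewrite /sphere /= => <-; apply: eq_bigr => j _; rewrite mxE sqrrN.
Qed.

Definition antipode (x : S) : S := to_sphere (sphere_opp (sphereP x)).

Lemma val_continuous : continuous (fun x : S => \val x : 'rV[R]_d.+1).
Proof. exact: (@initial_continuous S _ (@set_val _ (sphere R d))). Qed.

Lemma sphere_coord_continuous (j : 'I_d.+1) :
  continuous (fun x : S => (\val x : 'rV[R]_d.+1) ord0 j).
Proof.
move=> x; apply: (@continuous_comp S 'rV[R]_d.+1 R (fun x : S => \val x)
  (fun M : 'rV[R]_d.+1 => M ord0 j)); first exact: val_continuous.
exact: coord_continuous.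
Qed.

Lemma antipode_continuous : continuous antipode.
Proof.
apply: (@continuous_comp_initial S _ 'rV[R]_d.+1 (@set_val _ (sphere R d))).
move=> x; apply: (@continuous_comp S 'rV[R]_d.+1 'rV[R]_d.+1
  (fun x : S => \val x) -%R); first exact: val_continuous.
exact: opp_continuous.
Qed.

Lemma sphere_compact : compact (sphere R d).
Proof.
apply: bounded_closed_compact.
  exists 1; split; first exact: num_real.
  move=> M M1 x hx; apply: le_trans (ltW M1).
  rewrite /Num.norm /= mx_normrE; apply/bigmax_leP; split=> // -[i j] _ /=.
  rewrite ord1 -(@ler_pXn2r _ 2) ?nnegrE// expr1n real_normK ?num_real//.
  by rewrite -hx (bigD1 j)//= lerDl sumr_ge0// => k _; rewrite sqr_ge0.
have -> : sphere R d =
    (fun x : 'rV[R]_d.+1 => \sum_(j < d.+1) x ord0 j ^+ 2) @^-1` [set 1].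
  by [].
apply: preimage_closed; last exact: closed_eq.
move=> M _; move: M.
have addc : continuous (fun z : R * R => z.1 + z.2).
  by move=> z; exact: add_continuous.
apply: (@continuous_big R 'I_d.+1 +%R 0 xpredT addc 'rV[R]_d.+1 (index_enum _)
  (fun j x => x ord0 j ^+ 2)) => j _ x.
by apply: (@continuous_comp 'rV[R]_d.+1 R R (fun M => M ord0 j) (fun y => y ^+ 2));
  [exact: coord_continuous|exact: exprn_continuous].
Qed.

Lemma Sphere_compact : compact [set: S].
Proof.
move=> F FF _.
have FS : (@set_val _ (sphere R d) @ F) (sphere R d).
  apply: (@filterS _ F _ setT) => [x _|]; last exact: filterT.
  exact: (sphereP x).
have [x [hx cx]] := sphere_compact (fmap_proper_filter (@set_val _ (sphere R d)) FF) FS.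
exists (to_sphere hx); split=> // A B FA.
rewrite nbhsE => -[_ [[V oV <-] Vx] VB].
have GA : (@set_val _ (sphere R d) @ F) (@set_val _ (sphere R d) @` A).
  by apply: (@filterS _ F _ A) => // y Ay /=; exists y.
have Vx' : nbhs x V by apply: open_nbhs_nbhs.
have [_ [[y Ay <-] Vy]] := cx _ _ GA Vx'.
by exists y; split => //; exact: VB.
Qed.

End SphereTopology.

Section Modulus.
Variable R : realType.
Local Notation normc := (@Normc.normc R).

Lemma normcC (z : R[i]) : `|z| = (normc z)%:C%C.
Proof. by []. Qed.

Lemma normc_ge0 (z : R[i]) : 0 <= normc z.
Proof. by case: z => a b; rewrite sqrtr_ge0. Qed.

Lemma normc_triangle (y z : R[i]) : normc (y + z) <= normc y + normc z.
Proof. exact: le_normcD. Qed.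

Lemma normc_opp (z : R[i]) : normc (- z) = normc z.
Proof. exact: normcN. Qed.

Lemma normc_dist (y z : R[i]) : `|normc y - normc z| <= normc (y - z).
Proof.
rewrite ler_norml lerBlDr andbC -{1}(subrK z y) normc_triangle /=.
by rewrite lerNl opprB lerBlDr -{1}(subrK y z) -(opprB y z)
  (le_trans (normc_triangle _ _))// normc_opp.
Qed.

Lemma normc_conj (z : R[i]) : normc z^* = normc z.
Proof.
have := @norm_conjC _ z; rewrite !normcC => /eqP.
by rewrite eq_complex => /andP[/eqP].
Qed.

Lemma normc_Re (z : R[i]) : `|complex.Re z| <= normc z.
Proof. by have := normc_ge_Re z; rewrite normcC lecR. Qed.

Lemma normc_Im (z : R[i]) : `|complex.Im z| <= normc z.
Proof.
case: z => a b /=.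
by rewrite -sqrtr_sqr ler_wsqrtr// lerDr sqr_ge0.
Qed.

Lemma normc_le (z : R[i]) : normc z <= `|complex.Re z| + `|complex.Im z|.
Proof.
case: z => a b /=; rewrite -[leRHS]ger0_norm ?addr_ge0// -sqrtr_sqr ler_wsqrtr//.
by rewrite sqrrD !real_normK ?num_real// -addrA lerD2l lerDr mulrn_wge0 ?mulr_ge0.
Qed.

Lemma complex_cvgP (T : Type) (F : set_system T) (FF : Filter F) (f : T -> R[i]^o)
  (l : R[i]^o) :
  f @ F --> l <->
  forall e : R, 0 < e -> \forall y \near F, normc (l - f y) < e.
Proof.
split.
  move=> /cvgrPdist_lt fl e e0; have /fl : 0 < e%:C%C :> R[i] by rewrite ltcR.
  by apply: filterS => y; rewrite [`|_|]normcC ltcR.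
move=> fl; apply/cvgrPdist_lt => -[e e'] /[!ltcE]/= /andP[/eqP -> e0].
apply: filterS (fl e e0) => y; rewrite [`|_|]normcC => h.
by rewrite -[X in _ < X]/(e%:C%C) ltcR.
Qed.

Lemma complex_seq_complete (u : nat -> R[i]) :
  (forall e : R, 0 < e -> exists N : nat, forall m n : nat,
     (N <= m)%N -> (N <= n)%N -> normc (u m - u n) < e) ->
  exists l : R[i], forall e : R, 0 < e -> exists N : nat, forall n : nat,
    (N <= n)%N -> normc (u n - l) < e.
Proof.
have complete (v : nat -> R) :
    (forall e : R, 0 < e -> exists N : nat, forall m n : nat,
     (N <= m)%N -> (N <= n)%N -> `|v m - v n| < e) ->
    exists l : R, forall e : R, 0 < e -> exists N : nat, forall n : nat,
    (N <= n)%N -> `|v n - l| < e.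
  move=> hv; have /cauchy_cvg/cvg_ex[l /cvgrPdist_lt vl] : cauchy (v @ \oo).
    apply: cauchy_exP => e e0; have [N hN] := hv e e0.
    exists (v N); rewrite /ball /= nbhs_simpl/=; exists N => // n /= Nn.
    exact: hN.
  exists l => e /vl [N _ hN]; exists N => n Nn.
  by rewrite distrC; exact: hN.
move=> hu.
have [e e0|a ha] := complete (fun n => complex.Re (u n)).
  have [N hN] := hu e e0; exists N => m n Nm Nn.
  by apply: le_lt_trans (hN m n Nm Nn); rewrite -raddfB; exact: normc_Re.
have [e e0|b hb] := complete (fun n => complex.Im (u n)).
  have [N hN] := hu e e0; exists N => m n Nm Nn.
  by apply: le_lt_trans (hN m n Nm Nn); rewrite -raddfB; exact: normc_Im.
exists (Complex a b) => e e0.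
have e20 : 0 < e / 2 by rewrite divr_gt0.
have [N1 h1] := ha _ e20; have [N2 h2] := hb _ e20.
exists (maxn N1 N2) => n; rewrite geq_max => /andP[/h1 k1 /h2 k2].
apply: le_lt_trans (normc_le _) _; rewrite (splitr e) !raddfB/=.
exact: ltrD.
Qed.

End Modulus.

Section ContinuousOperations.
Variables (R : realType) (X : topologicalType).
Local Notation C := R[i]^o.

Lemma complex_continuousP (f : X -> C) : continuous f <->
  forall x (e : R), 0 < e -> \forall y \near x, Normc.normc (f x - f y) < e.
Proof. by split=> h x; apply/complex_cvgP; exact: h. Qed.

Lemma cts_add (f g : X -> C) :
  continuous f -> continuous g -> continuous (fun x => f x + g x : C).
Proof. by move=> cf cg x; apply: cvgD; [exact: cf|exact: cg]. Qed.

Lemma cts_opp (f : X -> C) : continuous f -> continuous (fun x => - f x : C).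
Proof. by move=> cf x; apply: cvgN; exact: cf. Qed.

Lemma cts_mul (f g : X -> C) :
  continuous f -> continuous g -> continuous (fun x => f x * g x : C).
Proof. by move=> cf cg x; apply: (@cvgM R[i]); [exact: cf|exact: cg]. Qed.

Lemma cts_conj (f : X -> C) :
  continuous f -> continuous (fun x => (f x : R[i])^* : C).
Proof.
move=> cf x; apply/complex_cvgP => e e0.
have /complex_cvgP/(_ e e0) := cf x.
by apply: filterS => y; rewrite -rmorphB normc_conj.
Qed.

Lemma cts_normc (f : X -> C) :
  continuous f -> continuous (fun x => Normc.normc (f x) : R).
Proof.
move=> cf x; apply/cvgrPdist_lt => e e0.
have /complex_cvgP/(_ e e0) := cf x.
by apply: filterS => y; apply: le_lt_trans (normc_dist _ _).
Qed.

End ContinuousOperations.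

(* Radial projection identifies S^d with the cross-polytope sum_k |x_k| = 1, the
   join of d + 1 copies of Z_2 = {+1, -1}; these are the join coordinates, the
   nonnegative weights of the vertices (-1)^g e_j. *)
Definition join_coordinate (R : realType) (d : nat) (g : 'Z_2) (j : 'I_d.+1)
    (x : Sphere R d) : R :=
  let v := \val x : 'rV[R]_d.+1 in
  Num.max 0 ((-1) ^+ g * v ord0 j) / \sum_(k < d.+1) `|v ord0 k|.

Section CSphereAlgebra.
Variables (R : realType) (d : nat).
Local Notation S := (Sphere R d).
Local Notation C := R[i]^o.
Local Notation T := (CSphere R d).
Local Notation normc := (@Normc.normc R).

Definition cs_of (f : S -> C) (hf : continuous f) : T :=
  [the continuousType S C of mkcts hf].

Lemma cs_ext (f g : T) : (forall x, f x = g x) -> f = g.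
Proof. by move=> fg; apply/continuousEP. Qed.

Lemma cs_continuous (f : T) : continuous f.
Proof. exact: cts_fun. Qed.

Definition cs_cst (l : R[i]) : T := cs_of (@cst_continuous S C l).
Definition cs_add (f g : T) : T :=
  cs_of (cts_add (@cs_continuous f) (@cs_continuous g)).
Definition cs_opp (f : T) : T := cs_of (cts_opp (@cs_continuous f)).
Definition cs_mul (f g : T) : T :=
  cs_of (cts_mul (@cs_continuous f) (@cs_continuous g)).
Definition cs_scale (l : R[i]) (f : T) : T := cs_mul (cs_cst l) f.
Definition cs_star (f : T) : T := cs_of (cts_conj (@cs_continuous f)).

HB.instance Definition _ := Choice.copy T (continuousType S C).

Fact cs_addA : associative cs_add.
Proof. by move=> f g h; apply: cs_ext => x; exact: addrA. Qed.
Fact cs_addC : commutative cs_add.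
Proof. by move=> f g; apply: cs_ext => x; exact: addrC. Qed.
Fact cs_add0 : left_id (cs_cst 0) cs_add.
Proof. by move=> f; apply: cs_ext => x; exact: add0r. Qed.
Fact cs_addN : left_inverse (cs_cst 0) cs_opp cs_add.
Proof. by move=> f; apply: cs_ext => x; exact: addNr. Qed.
HB.instance Definition _ :=
  GRing.isZmodule.Build T cs_addA cs_addC cs_add0 cs_addN.

Fact cs_mulA : associative cs_mul.
Proof. by move=> f g h; apply: cs_ext => x; exact: mulrA. Qed.
Fact cs_mulC : commutative cs_mul.
Proof. by move=> f g; apply: cs_ext => x; exact: mulrC. Qed.
Fact cs_mul1 : left_id (cs_cst 1) cs_mul.
Proof. by move=> f; apply: cs_ext => x; exact: mul1r. Qed.
Fact cs_mulDl : left_distributive cs_mul cs_add.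
Proof. by move=> f g h; apply: cs_ext => x; exact: mulrDl. Qed.
Fact cs_1neq0 : cs_cst 1 != 0.
Proof.
apply/eqP => /continuousEP/(_ (to_sphere (sphere_nonempty R d)))/eqP.
exact/negP/oner_neq0.
Qed.
HB.instance Definition _ := GRing.Zmodule_isComNzRing.Build T
  cs_mulA cs_mulC cs_mul1 cs_mulDl cs_1neq0.

Fact cs_scaleA l m (f : T) : cs_scale l (cs_scale m f) = cs_scale (l * m) f.
Proof. by apply: cs_ext => x; exact: mulrA. Qed.
Fact cs_scale1 : left_id 1 cs_scale.
Proof. by move=> f; apply: cs_ext => x; exact: mul1r. Qed.
Fact cs_scaleDr : right_distributive cs_scale +%R.
Proof. by move=> l f g; apply: cs_ext => x; exact: mulrDr. Qed.
Fact cs_scaleDl (f : T) : {morph cs_scale^~ f : l m / l + m}.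
Proof. by move=> l m; apply: cs_ext => x; exact: mulrDl. Qed.
HB.instance Definition _ := GRing.Zmodule_isLmodule.Build R[i] T
  cs_scaleA cs_scale1 cs_scaleDr cs_scaleDl.

Fact cs_scaleAl (l : R[i]) (f g : T) : l *: (f * g) = (l *: f) * g.
Proof. by apply: cs_ext => x; exact: mulrA. Qed.
HB.instance Definition _ := GRing.Lmodule_isLalgebra.Build R[i] T cs_scaleAl.
HB.instance Definition _ := GRing.Lalgebra_isComAlgebra.Build R[i] T.

Definition cs_norm (f : T) : R := sup [set normc (f x) | x in [set: S]].

Lemma cs_norm_has_sup (f : T) : has_sup [set normc (f x) | x in [set: S]].
Proof.
have x0 := to_sphere (sphere_nonempty R d).
split; first by exists (normc (f x0)); exists x0.
have cf := cts_normc (@cs_continuous f).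
have [|c _ hc] := compact_EVT_max _ (@Sphere_compact R d)
  (continuous_subspaceT cf); first by exists x0.
by exists (normc (f c)) => _ [x _ <-]; apply: hc; rewrite inE.
Qed.

Lemma cs_norm_ub (f : T) (x : S) : normc (f x) <= cs_norm f.
Proof.
by apply: ub_le_sup; [exact: (cs_norm_has_sup f).2|exists x].
Qed.

Lemma cs_norm_le (f : T) (M : R) : (forall x, normc (f x) <= M) ->
  cs_norm f <= M.
Proof.
move=> h; apply: ge_sup; first exact: (cs_norm_has_sup f).1.
by move=> _ [x _ <-].
Qed.

Lemma cs_norm_ge0 (f : T) : 0 <= cs_norm f.
Proof.
exact: le_trans (normc_ge0 _) (cs_norm_ub f (to_sphere (sphere_nonempty R d))).
Qed.

Fact cs_normD (f g : T) : cs_norm (f + g) <= cs_norm f + cs_norm g.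
Proof.
apply: cs_norm_le => x; apply: le_trans (normc_triangle _ _) _.
by apply: lerD; exact: cs_norm_ub.
Qed.

Fact cs_normM (f g : T) : cs_norm (f * g) <= cs_norm f * cs_norm g.
Proof.
apply: cs_norm_le => x; rewrite -[(f * g) x]/(f x * g x) Normc.normcM.
by apply: ler_pM; rewrite ?normc_ge0// cs_norm_ub.
Qed.

Fact cs_norm0_eq0 (f : T) : cs_norm f = 0 -> f = 0.
Proof.
move=> f0; apply: cs_ext => x; apply: Normc.eq0_normc.
by apply/eqP; rewrite eq_le normc_ge0 -f0 cs_norm_ub.
Qed.

Fact cs_normZ (l : R[i]) (f : T) : cs_norm (l *: f) = normc l * cs_norm f.
Proof.
apply/eqP; rewrite eq_le; apply/andP; split.
  apply: cs_norm_le => x; rewrite -[(l *: f) x]/(l * f x) Normc.normcM.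
  by rewrite ler_wpM2l ?normc_ge0 ?cs_norm_ub.
have [->|l0] := eqVneq l 0; first by rewrite Normc.normc0 mul0r cs_norm_ge0.
have nl : 0 < normc l.
  by rewrite lt_def normc_ge0 andbT; apply: contra_neq l0; exact: Normc.eq0_normc.
rewrite -ler_pdivlMl//; apply: cs_norm_le => x; rewrite ler_pdivlMl//.
by rewrite -Normc.normcM; exact: (cs_norm_ub (l *: f)).
Qed.

Fact cs_norm_star (f : T) : cs_norm (cs_star f * f) = cs_norm f ^+ 2.
Proof.
have E x : normc ((cs_star f * f) x) = normc (f x) ^+ 2.
  by rewrite -[(cs_star f * f) x]/((f x)^* * f x) Normc.normcM normc_conj expr2.
apply/eqP; rewrite eq_le; apply/andP; split.
  by apply: cs_norm_le => x; rewrite E ler_sqr ?nnegrE ?normc_ge0 ?cs_norm_ge0 ?cs_norm_ub.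
have h : 0 <= cs_norm (cs_star f * f) by exact: cs_norm_ge0.
rewrite -[leRHS]sqr_sqrtr// ler_sqr ?nnegrE ?cs_norm_ge0//.
apply: cs_norm_le => x; rewrite -[leLHS]ger0_norm ?normc_ge0// -sqrtr_sqr.
by rewrite ler_wsqrtr// -E cs_norm_ub.
Qed.

Fact cs_complete (u : nat -> T) :
  (forall e : R, 0 < e -> exists N : nat, forall m n : nat,
     (N <= m)%N -> (N <= n)%N -> cs_norm (u m - u n) < e) ->
  exists l : T, forall e : R, 0 < e -> exists N : nat, forall n : nat,
    (N <= n)%N -> cs_norm (u n - l) < e.
Proof.
move=> hu.
have /choice[g hg] (x : S) := complex_seq_complete
  (fun e e0 => let: ex_intro N hN := hu e e0 in ex_intro _ N
    (fun m n Nm Nn => le_lt_trans (cs_norm_ub (u m - u n) x) (hN m n Nm Nn))).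
have unif e : 0 < e -> exists N : nat, forall n, (N <= n)%N ->
    forall x, normc (u n x - g x) <= e.
  move=> e0; have e20 : 0 < e / 2 by rewrite divr_gt0.
  have [N hN] := hu _ e20; exists N => n Nn x.
  have [M hM] := hg x _ e20; set k := maxn N M.
  have -> : u n x - g x = (u n x - u k x) + (u k x - g x) by rewrite subrKA.
  apply: le_trans (normc_triangle _ _) _; rewrite [leRHS]splitr lerD//.
    apply: le_trans (cs_norm_ub (u n - u k) x) _.
    by apply/ltW/hN => //; exact: leq_maxl.
  by apply/ltW/hM; exact: leq_maxr.
have cg : continuous (g : S -> C).
  apply/complex_continuousP => x e e0.
  have e30 : 0 < e / 3 by rewrite divr_gt0.
  have [N hN] := unif _ e30.
  have /complex_continuousP/(_ x _ e30) := @cs_continuous (u N).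
  apply: (@filterS _ _ (nbhs_filter x)) => y uy.
  have -> : g x - g y = (g x - u N x) + (u N x - u N y) + (u N y - g y).
    by rewrite subrKA subrKA.
  have -> : e = e / 3 + e / 3 + e / 3 by lra.
  apply: le_lt_trans (normc_triangle _ _) _; apply: ltr_leD; last exact: hN.
  apply: le_lt_trans (normc_triangle _ _) _; apply: ler_ltD => //.
  by rewrite -normc_opp opprB hN.
exists (cs_of cg) => e e0.
have e20 : 0 < e / 2 by rewrite divr_gt0.
have [N hN] := unif _ e20; exists N => n Nn.
apply: (@le_lt_trans _ _ (e / 2)); last by rewrite ltr_pdivrMr// ltr_pMr// ltr1n.
by apply: cs_norm_le => x; exact: hN.
Qed.

Fact cs_starD (f g : T) : cs_star (f + g) = cs_star f + cs_star g.
Proof. by apply: cs_ext => x; exact: rmorphD. Qed.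
Fact cs_starZ (l : R[i]) (f : T) : cs_star (l *: f) = l^* *: cs_star f.
Proof. by apply: cs_ext => x; exact: rmorphM. Qed.
Fact cs_starM (f g : T) : cs_star (f * g) = cs_star g * cs_star f.
Proof. by rewrite mulrC; apply: cs_ext => x; exact: rmorphM. Qed.
Fact cs_starK : involutive cs_star.
Proof. by move=> f; apply: cs_ext => x; exact: conjCK. Qed.

HB.instance Definition _ := isCStarAlgebra.Build R T
  cs_normD cs_normZ cs_norm0_eq0 cs_normM cs_complete
  cs_starD cs_starZ cs_starM cs_starK cs_norm_star.

Definition sphere_act (g : 'Z_2) (x : S) : S := iter g (@antipode R d) x.

Lemma sphere_act_continuous (g : 'Z_2) : continuous (sphere_act g).
Proof.
rewrite /sphere_act; elim: (g : nat) => [|n ih] x; first exact: cvg_id.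
apply: (@continuous_comp S S S (iter n (@antipode R d)) (@antipode R d)).
  exact: ih.
exact: antipode_continuous.
Qed.

Lemma antipodal_subproof (g : 'Z_2) (f : T) :
  continuous (fun x => f (sphere_act (- g) x) : C).
Proof.
move=> x; apply: (@continuous_comp S S C (sphere_act (- g)) f).
  exact: sphere_act_continuous.
exact: cs_continuous.
Qed.

Definition antipodal_action (g : 'Z_2) (f : T) : T :=
  cs_of (@antipodal_subproof g f).

Lemma antipodeK : involutive (@antipode R d).
Proof. by move=> x; apply/val_inj; rewrite /= opprK. Qed.

Lemma sphere_actD (g h : 'Z_2) (x : S) :
  sphere_act (g + h) x = sphere_act g (sphere_act h x).
Proof.
case: g => -[|[|//]] ? //; case: h => -[|[|//]] ? //.
by rewrite /sphere_act /= antipodeK.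
Qed.

Lemma antipodal_actionP : Z2_action antipodal_action.
Proof.
have act0 : antipodal_action 0 =1 id by move=> f; apply: cs_ext.
have actD g h : antipodal_action (g + h) =1
    antipodal_action g \o antipodal_action h.
  move=> f; apply: cs_ext => x; rewrite /= /mkcts opprD addrC.
  by rewrite sphere_actD.
split=> // g; split; last first.
  exists (antipodal_action (- g)) => f.
    by rewrite -[LHS]actD addNr act0.
  by rewrite -[LHS]actD addrN act0.
split.
- by move=> l f h; apply: cs_ext.
- by split=> [|f h]; apply: cs_ext.
- by move=> f; apply: cs_ext.
Qed.

End CSphereAlgebra.

(* Main.v *)
(* Bernstein's proof of the Weierstrass theorem, carried out in an abstract
   C*-algebra.  The generators form a commuting family [b i] of positive elements
   of sum 1, so the products [b w] of the letters of the words [w] of length [n]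
   are positive and sum to 1.  A word without clashing letters ((0, j) together
   with (1, j)) has letter frequencies lying on the join of d + 1 copies of Z_2,
   i.e. defining a point of S^d; words with clashes contribute 0.  For F in C(S^d)
   the sums [\sum_w F (point of w) *: b w] form a Cauchy sequence, by Chebyshev's
   inequality, in the order of the algebra, and compactness of S^d.  The limit
   defines the morphism C(S^d) -> B, and comparing [F] with its values at the
   points of words shows that it is the only one.  The order-theoretic facts that
   this needs come from the square root of [1 - a] for selfadjoint [a] of norm at
   most 1, so no Gelfand theory and no spectral radius formula enter. *)
Require Import Defs.
From mathcomp Require Import all_boot all_order all_algebra.
From mathcomp Require Import complex ring lra.
From mathcomp Require Import all_classical all_reals all_analysis.
Import Order.TTheory GRing.Theory Num.Theory.
Import numFieldNormedType.Exports.

Set Implicit Arguments.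
Unset Strict Implicit.
Unset Printing Implicit Defensive.

Local Open Scope classical_set_scope.
Local Open Scope ring_scope.

(** * Positivity in C*-algebras *)

Section CStarBasics.
Variables (R : realType) (B : cstarAlgType R).
Implicit Types (a b h k p q x y : B) (s t : R).

Lemma normc_real t : Normc.normc (t%:C)%C = `|t|.
Proof. by rewrite /= expr0n /= addr0 sqrtr_sqr. Qed.

(** Real scalars are embedded as central elements, so that mixed identities between scalars and
    elements become plain ring computations. *)
Definition rscal t : B := (t%:C)%C%:A.

Lemma rsD s t : rscal (s + t) = rscal s + rscal t.
Proof. by rewrite /rscal rmorphD /= scalerDl. Qed.

Lemma rsN t : rscal (- t) = - rscal t.
Proof. by rewrite /rscal rmorphN /= scaleNr. Qed.

Lemma rsB s t : rscal (s - t) = rscal s - rscal t.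
Proof. by rewrite rsD rsN. Qed.

Lemma rsM s t : rscal (s * t) = rscal s * rscal t.
Proof. by rewrite /rscal rmorphM /= -scalerAl mul1r scalerA. Qed.

Lemma rs0 : rscal 0 = 0. Proof. by rewrite /rscal scale0r. Qed.

Lemma rs1 : rscal 1 = 1. Proof. by rewrite /rscal scale1r. Qed.

Lemma rs_comm t x : rscal t * x = x * rscal t.
Proof. by rewrite /rscal -scalerAl mul1r -scalerAr mulr1. Qed.

Lemma rs_nat n : rscal n%:R = n%:R.
Proof. by rewrite /rscal rmorph_nat scaler_nat. Qed.

Lemma rs_sum (I : Type) (r : seq I) (F : I -> R) :
  rscal (\sum_(i <- r) F i) = \sum_(i <- r) rscal (F i).
Proof. by rewrite /rscal rmorph_sum /= scaler_suml. Qed.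

Lemma rs_mulC s x y : x * (rscal s * y) = rscal s * (x * y).
Proof. by rewrite mulrA -rs_comm mulrA. Qed.

Lemma rs_sqr s x : (rscal s * x) * (rscal s * x) = rscal (s ^+ 2) * (x * x).
Proof. by rewrite -mulrA rs_mulC mulrA -rsM -expr2. Qed.

Lemma star0 : star (0 : B) = 0.
Proof. by rewrite -[in LHS](scale0r (0 : B)) starZ conjC0 scale0r. Qed.

Lemma starN a : star (- a) = - star a.
Proof. by rewrite -scaleN1r starZ rmorphN rmorph1 scaleN1r. Qed.

Lemma starB a b : star (a - b) = star a - star b.
Proof. by rewrite starD starN. Qed.

Lemma star1 : star (1 : B) = 1.
Proof.
have : star (1 * star 1) = star 1 :> B by rewrite starM starK mul1r.
by rewrite mul1r starK => <-.
Qed.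

Lemma star_rs t : star (rscal t) = rscal t.
Proof. by rewrite /rscal starZ star1; congr (_ *: _); exact: conjc_real. Qed.

Lemma star_sum (I : Type) (r : seq I) (F : I -> B) :
  star (\sum_(i <- r) F i) = \sum_(i <- r) star (F i).
Proof. exact: (big_morph _ starD star0). Qed.

Lemma cnorm0 : cnorm (0 : B) = 0.
Proof. by rewrite -(scale0r (0 : B)) cnormZ Normc.normc0 mul0r. Qed.

Lemma cnormN a : cnorm (- a) = cnorm a.
Proof. by rewrite -scaleN1r cnormZ normcN Normc.normc1 mul1r. Qed.

Lemma cnormBC a b : cnorm (a - b) = cnorm (b - a).
Proof. by rewrite -cnormN opprB. Qed.

Lemma cnorm_ge0 a : 0 <= cnorm a.
Proof.
have := cnormD a (- a); rewrite subrr cnorm0 cnormN -mulr2n.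
by rewrite pmulrn_lge0.
Qed.

(** The C*-identity and submultiplicativity give |x|^2 <= |x*| |x|; cancel |x|, then apply the
    result to x* as well. *)
Lemma cnorm_star a : cnorm (star a) = cnorm a.
Proof.
have h (x : B) : cnorm x <= cnorm (star x).
  have := cnormM (star x) x; rewrite cnorm_starM expr2.
  have [->|x0] := eqVneq (cnorm x) 0; first by rewrite cnorm_ge0.
  by rewrite ler_pM2r// lt_def x0 cnorm_ge0.
by apply/eqP; rewrite eq_le h andbT -{2}(starK a) h.
Qed.

Lemma cnorm1 : cnorm (1 : B) = 1.
Proof.
have := cnorm_starM (1 : B); rewrite star1 mulr1 => /eqP.
rewrite -subr_eq0 expr2 -{1}[cnorm 1]mulr1 -mulrBr mulf_eq0 => /orP[/eqP h|].
  by move/cnorm0_eq0: h => /eqP; rewrite oner_eq0.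
by rewrite subr_eq0 => /eqP.
Qed.

Lemma cnorm_rsM t a : cnorm (rscal t * a) = `|t| * cnorm a.
Proof. by rewrite /rscal -scalerAl mul1r cnormZ normc_real. Qed.

Lemma cnorm_rs t : cnorm (rscal t) = `|t|.
Proof. by rewrite -[rscal t]mulr1 cnorm_rsM cnorm1 mulr1. Qed.

Lemma cnorm_le0 a : cnorm a <= 0 -> a = 0.
Proof. by move=> h; apply/cnorm0_eq0/eqP; rewrite eq_le h cnorm_ge0. Qed.

(** The structure provides a norm but no topology, so convergence is that of a real sequence, and
    limit theorems in R can be reused. *)
Definition ccvg (u : nat -> B) (l : B) :=
  (fun n => cnorm (u n - l)) @ \oo --> (0 : R).

Lemma ccvg_dominated u l (r : nat -> R) :
  (\forall n \near \oo, cnorm (u n - l) <= r n) -> r @ \oo --> (0 : R) -> ccvg u l.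
Proof.
move=> ur r0; apply: (squeeze_cvgr (f := fun=> 0) (h := r)) => //; last exact: cvg_cst.
by apply: filterS ur => n ->; rewrite cnorm_ge0.
Qed.

Lemma ccvg_cst l : ccvg (fun=> l) l.
Proof. by rewrite /ccvg subrr cnorm0; exact: cvg_cst. Qed.

Lemma ccvgD u v l m : ccvg u l -> ccvg v m -> ccvg (fun n => u n + v n) (l + m).
Proof.
move=> ul vm; apply: (ccvg_dominated (r := fun n => cnorm (u n - l) + cnorm (v n - m))).
  by near=> n; rewrite opprD addrACA cnormD.
by rewrite -[X in _ --> X](addr0 0); exact: cvgD.
Unshelve. all: by end_near. Qed.

Lemma ccvgM u v l m : ccvg u l -> ccvg v m -> ccvg (fun n => u n * v n) (l * m).
Proof.
move=> ul vm; apply: (ccvg_dominated (r := fun n =>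
  cnorm (u n - l) * cnorm (v n - m) + cnorm (u n - l) * cnorm m
  + cnorm l * cnorm (v n - m))).
  near=> n.
  have -> : u n * v n - l * m = (u n - l) * (v n - m) + (u n - l) * m
      + l * (v n - m) by rewrite -mulrDr subrK mulrBl mulrBr addrA subrK.
  apply: le_trans (cnormD _ _) _; apply: lerD; last exact: cnormM.
  by apply: le_trans (cnormD _ _) _; apply: lerD; exact: cnormM.
have -> : (0 : R) = 0 * 0 + 0 * cnorm m + cnorm l * 0 by rewrite !mulr0 mul0r !addr0.
apply: cvgD; last exact: cvgMl_tmp.
by apply: cvgD; [exact: cvgM|exact: cvgMr_tmp].
Unshelve. all: by end_near. Qed.

Lemma ccvgZ u l c : ccvg u l -> ccvg (fun n => c *: u n) (c *: l).
Proof.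
move=> ul; apply: (ccvg_dominated (r := fun n => Normc.normc c * cnorm (u n - l))).
  by near=> n; rewrite -scalerBr cnormZ.
by rewrite -[X in _ --> X](mulr0 (Normc.normc c)); exact: cvgMl_tmp.
Unshelve. all: by end_near. Qed.

Lemma ccvg_star u l : ccvg u l -> ccvg (fun n => star (u n)) (star l).
Proof.
by move=> ul; rewrite /ccvg; under eq_fun do rewrite -starB cnorm_star.
Qed.

Lemma ccvg_unique u l m : ccvg u l -> ccvg u m -> l = m.
Proof.
move=> ul um; apply/eqP; rewrite -subr_eq0; apply/eqP/cnorm_le0.
rewrite -[leRHS](addr0 0); apply: (cvgr_to_ge (cvgD ul um)).
near=> n; have -> : l - m = (u n - m) - (u n - l) by rewrite opprB [RHS]addrC subrKA.
by rewrite addrC; apply: le_trans (cnormD _ _) _; rewrite cnormN lerD2l.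
Unshelve. all: by end_near. Qed.

Lemma ccvgP u l : (forall e, 0 < e -> exists N, forall n, (N <= n)%N ->
  cnorm (u n - l) <= e) -> ccvg u l.
Proof.
move=> h; apply/cvgrPdist_le => e /h[N hN].
by exists N => // n /= Nn; rewrite sub0r normrN ger0_norm ?cnorm_ge0// hN.
Qed.

Lemma ccvg_cauchy u : (forall e : R, 0 < e -> exists N : nat, forall m n : nat,
    (N <= m)%N -> (N <= n)%N -> cnorm (u m - u n) < e) ->
  exists l, ccvg u l.
Proof.
move=> /cnorm_complete[l hl]; exists l; apply: ccvgP => e /hl[N hN].
by exists N => n Nn; exact/ltW/hN.
Qed.

Lemma ccvg_eq u v l m : ccvg u l -> ccvg v m -> ccvg (fun n => u n - v n) 0 -> l = m.
Proof.
move=> ul vm uv; apply: (ccvg_unique ul).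
suff -> : u = (fun n => (u n - v n) + v n) by rewrite -[m]add0r; exact: ccvgD.
by apply/funext => n; rewrite subrK.
Qed.

(** Majorant method: by telescoping, |u_m - u_n| <= t_m - t_n for n <= m, and [t] is nondecreasing
    and bounded, hence Cauchy. *)
Lemma ccvg_majorant u (t : nat -> R) M :
  (forall n, cnorm (u n.+1 - u n) <= t n.+1 - t n) -> (forall n, t n <= M) ->
  exists l, ccvg u l.
Proof.
move=> ut tM.
have t_nd : nondecreasing_seq t.
  by apply/nondecreasing_seqP => n; rewrite -subr_ge0 (le_trans _ (ut n))// cnorm_ge0.
have umn m n : cnorm (u (n + m)%N - u n) <= t (n + m)%N - t n.
  elim: m => [|m ih]; first by rewrite addn0 !subrr cnorm0.
  rewrite addnS -(subrKA (u (n + m)%N)) -(subrKA (t (n + m)%N)).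
  by apply: le_trans (cnormD _ _) _; apply: lerD.
have tcvg : cvgn t.
  by apply: nondecreasing_is_cvgn => //; exists M => _ [n _ <-].
have le_lim n : t n <= limn t by exact: nondecreasing_cvgn_le.
apply: ccvg_cauchy => e e0; have /cvgrPdist_lt/(_ _ e0)[N _ hN] := tcvg.
have uN (k m : nat) : (N <= k)%N -> (k <= m)%N -> cnorm (u m - u k) < e.
  move=> Nk km; rewrite -(subnKC km); apply: le_lt_trans (umn _ _) _.
  apply: le_lt_trans (hN k Nk); rewrite ger0_norm ?subr_ge0//.
  by rewrite lerD2r.
exists N => m n Nm Nn; have [mn|/ltnW nm] := leqP m n; last exact: uN.
by rewrite cnormBC; exact: uN.
Qed.

Lemma ccvg_shift u l : ccvg u l -> ccvg (fun n => u n.+1) l.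
Proof.
by move=> ul; rewrite /ccvg (cvg_shiftS (fun n => cnorm (u n - l))).
Qed.

Lemma cnorm_sa h : star h = h -> cnorm (h * h) = cnorm h ^+ 2.
Proof. by move=> hh; rewrite -cnorm_starM hh. Qed.

Lemma ccvg_comm u l y :
  (forall n, u n * y = y * u n) -> ccvg u l -> l * y = y * l.
Proof.
move=> uy ul; apply: (ccvg_unique (ccvgM ul (ccvg_cst y))).
under eq_fun do rewrite uy.
exact: ccvgM (ccvg_cst y) ul.
Qed.

(* With [w = 1 - q], the equation [q * q = 1 - a] reads [w = (a + w * w) / 2];
   iterating from [0] is majorized by the scalar iteration for [a = 1]. *)
Lemma sqrt_1B a : star a = a -> cnorm a <= 1 ->
  exists q, [/\ star q = q, q * q = 1 - a &
    forall y, a * y = y * a -> q * y = y * q].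
Proof.
move=> sa a1.
pose w := fix w n := if n is n.+1 then rscal 2^-1 * (a + w n * w n) else 0.
pose t := fix t n : R := if n is n.+1 then 2^-1 * (1 + t n * t n) else 0.
have t01 n : 0 <= t n <= 1.
  by elim: n => [|n /andP[ih0 ih1]] /=; [rewrite lexx ler01|nra].
have wt n : cnorm (w n) <= t n.
  elim: n => [|n ih]; first by rewrite cnorm0.
  rewrite /= cnorm_rsM ger0_norm ?invr_ge0// ler_pM2l ?invr_gt0//.
  apply: le_trans (cnormD _ _) _; apply: lerD => //.
  by apply: le_trans (cnormM _ _) _; rewrite ler_pM ?cnorm_ge0.
have wS n : cnorm (w n.+1 - w n) <= t n.+1 - t n.
  elim: n => [|n ih].
    rewrite /= !mulr0 !addr0 !subr0 cnorm_rsM ger0_norm ?invr_ge0//.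
    by rewrite mulr1 ler_piMr// invr_ge0.
  (* The splitting x x - y y = (x - y) x + y (x - y) holds without commutativity; the same splitting
     of [t] lets the bounds be compared term by term. *)
  have -> : w n.+2 - w n.+1 = rscal 2^-1 *
      ((w n.+1 - w n) * w n.+1 + w n * (w n.+1 - w n)).
    have -> : w n.+2 - w n.+1 = rscal 2^-1 * (a + w n.+1 * w n.+1)
      - rscal 2^-1 * (a + w n * w n) by [].
    rewrite -mulrBr opprD addrACA subrr add0r; congr (_ * _).
    by rewrite mulrBl mulrBr subrKA.
  have -> : t n.+2 - t n.+1 =
      2^-1 * ((t n.+1 - t n) * t n.+1 + t n * (t n.+1 - t n)).
    have -> : t n.+2 - t n.+1 =
      2^-1 * (1 + t n.+1 * t n.+1) - 2^-1 * (1 + t n * t n) by [].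
    by ring.
  rewrite cnorm_rsM ger0_norm ?invr_ge0// ler_pM2l ?invr_gt0//.
  by apply: le_trans (cnormD _ _) _; apply: lerD; apply: le_trans (cnormM _ _) _;
    rewrite ler_pM ?cnorm_ge0.
have [l wl] := ccvg_majorant wS (fun n => proj2 (andP (t01 n))).
have lE : l = rscal 2^-1 * (a + l * l).
  apply: (ccvg_unique (ccvg_shift wl)) => /=.
  by apply: ccvgM (ccvg_cst _) (ccvgD (ccvg_cst _) (ccvgM wl wl)).
have l2 : l + l = a + l * l.
  rewrite -mulr2n -mulr_natl -rs_nat {1}lE mulrA -rsM divff ?pnatr_eq0//.
  by rewrite rs1 mul1r.
exists (1 - l); split.
- rewrite starB star1; congr (_ - _); apply: (ccvg_unique (ccvg_star wl)).
  suff -> : (fun n => star (w n)) = w by [].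
  apply/funext; elim=> [|n ih] /=; first exact: star0.
  by rewrite starM star_rs starD starM sa ih rs_comm.
- have -> : a = l + l - l * l by rewrite l2 addrK.
  by rewrite mulrBl mul1r mulrBr mulr1 -addrA -opprD addrA.
- move=> y ay; rewrite mulrBl mulrBr mul1r mulr1; congr (_ - _).
  apply: ccvg_comm wl; elim=> [|n ih] /=; first by rewrite mul0r mulr0.
  rewrite -mulrA rs_mulC; congr (_ * _); rewrite mulrDl mulrDr.
  by rewrite ay -mulrA ih mulrA ih mulrA.
Qed.

(** For u = h + i k, commutation gives u* u = h^2 + k^2 = t^2, so |u| = t by the C*-identity; then 2
    h = u + u* has norm at most 2 t. *)
Lemma cnorm_sqD h k t : star h = h -> star k = k -> h * k = k * h -> 0 <= t ->
  h * h + k * k = rscal (t ^+ 2) -> cnorm h <= t.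
Proof.
move=> sh sk hk t0 hkt; pose u := h + 'i *: k.
have su : star u = h - 'i *: k by rewrite starD starZ sh sk conjCi scaleNr.
have ii : 'i * 'i = -1 :> R[i] by rewrite -expr2 sqrCi.
have ut : cnorm u = t.
  apply/eqP; rewrite -(@eqrXn2 _ 2)// ?cnorm_ge0// -cnorm_starM su.
  have -> : (h - 'i *: k) * u = rscal (t ^+ 2).
    rewrite -hkt /u mulrBl !mulrDr -!scalerAl -!scalerAr scalerA.
    by rewrite ii scaleN1r hk opprD opprK addrA addrK.
  by rewrite cnorm_rs ger0_norm// sqr_ge0.
have h2 : rscal 2 * h = u + star u.
  by rewrite su addrACA subrr addr0 rs_nat mulr_natl mulr2n.
have : cnorm (rscal 2 * h) <= t + t.
  by rewrite h2; apply: le_trans (cnormD _ _) _; rewrite cnorm_star ut.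
by rewrite cnorm_rsM ger0_norm// => ?; lra.
Qed.

(** A standard form of positivity that avoids the spectrum: sums follow from the triangle
    inequality, and after rescaling p is 1 - a with |a| <= 1, the input of [sqrt_1B]. *)
Definition pos p := star p = p /\ exists2 t, 0 <= t & cnorm (rscal t - p) <= t.

Lemma pos_sub_norm h t : star h = h -> cnorm h <= t -> pos (rscal t - h).
Proof.
move=> sh ht; split; first by rewrite starB star_rs sh.
exists t; first exact: le_trans (cnorm_ge0 h) ht.
by rewrite opprB addrCA subrr addr0.
Qed.

Lemma posD p q : pos p -> pos q -> pos (p + q).
Proof.
move=> [sp [s s0 hs]] [sq [t t0 ht]]; split; first by rewrite starD sp sq.
exists (s + t); first exact: addr_ge0.
by rewrite rsD opprD addrACA; apply: le_trans (cnormD _ _) _; exact: lerD.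
Qed.

Lemma pos_scale t p : 0 <= t -> pos p -> pos (rscal t * p).
Proof.
move=> t0 [sp [s s0 hs]]; split; first by rewrite starM star_rs sp rs_comm.
exists (t * s); first exact: mulr_ge0.
by rewrite rsM -mulrBr cnorm_rsM ger0_norm// ler_wpM2l.
Qed.

Lemma pos0 : pos 0.
Proof. by split; [exact: star0|exists 0; rewrite // rs0 subrr cnorm0]. Qed.

Lemma pos_rs t : 0 <= t -> pos (rscal t).
Proof.
by move=> t0; split; [exact: star_rs|exists t; rewrite // subrr cnorm0].
Qed.

Lemma pos_sum (I : Type) (r : seq I) (F : I -> B) :
  (forall i, pos (F i)) -> pos (\sum_(i <- r) F i).
Proof.
by move=> hF; elim/big_rec : _ => [|i x _ hx]; [exact: pos0|exact: posD].
Qed.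

(** For t > 0, p / t = 1 - a with a = (t - p) / t of norm at most 1; rescale the root of 1 - a by
    the square root of t. The commutation clause is what later makes the roots of commuting elements
    commute. *)
Lemma pos_sqrt p : pos p -> exists q, [/\ star q = q, q * q = p &
  forall y, p * y = y * p -> q * y = y * q].
Proof.
move=> [sp [t t0 word_point]].
have [t00|tn0] := eqVneq t 0.
  have p0 : 0 = p.
    by move: word_point; rewrite t00 rs0 sub0r => /cnorm_le0/eqP; rewrite oppr_eq0 => /eqP.
  by exists 0; split=> [||y _]; rewrite ?star0 ?mulr0 ?mul0r.
have tpos : 0 < t by rewrite lt_def tn0.
pose a := rscal t^-1 * (rscal t - p).
have aE : a = 1 - rscal t^-1 * p by rewrite /a mulrBr -rsM mulVf// rs1.
have [||q [sq qq qc]] := @sqrt_1B a.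
- by rewrite starM starB !star_rs sp -rs_comm.
- by rewrite cnorm_rsM ger0_norm ?invr_ge0// ler_pdivrMl// mulr1.
exists (rscal (Num.sqrt t) * q); split.
- by rewrite starM sq star_rs rs_comm.
- by rewrite rs_sqr sqr_sqrtr// qq aE subKr mulrA -rsM divff// rs1 mul1r.
- move=> y py; rewrite -mulrA rs_mulC qc// aE mulrBl mulrBr mul1r mulr1.
  by rewrite -mulrA rs_mulC py.
Qed.

(** Let s = |h| > 0 and let k be the root of 1 - h^2 / s^2. Then h^2 + (s k)^2 = s^2, so |s k| <= s
    by [cnorm_sqD], and |s^2 - h^2| = |(s k)^2| <= s^2. *)
Lemma pos_sqr h : star h = h -> pos (h * h).
Proof.
move=> sh; split; first by rewrite starM sh.
have [h0|hn0] := eqVneq (cnorm h) 0.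
  exists 0 => //; move/cnorm0_eq0: h0 => ->.
  by rewrite mulr0 rs0 subr0 cnorm0.
have hpos : 0 < cnorm h by rewrite lt_def hn0 cnorm_ge0.
exists (cnorm h ^+ 2); first exact: sqr_ge0.
have [||k [sk kk kc]] := @sqrt_1B (rscal (cnorm h ^- 2) * (h * h)).
- by rewrite starM star_rs starM sh rs_comm.
- by rewrite cnorm_rsM cnorm_sa// ger0_norm ?invr_ge0 ?sqr_ge0// mulVf// sqrf_eq0.
have hk : h * k = k * h.
  by apply/esym/kc; rewrite rs_mulC -!mulrA.
set s := cnorm h in hn0 hpos kk kc *.
have s2 : s ^+ 2 != 0 by rewrite sqrf_eq0.
have -> : rscal (s ^+ 2) - h * h = (rscal s * k) * (rscal s * k).
  rewrite rs_sqr kk mulrBr mulr1 (mulrA (rscal (s ^+ 2))) -rsM divff//.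
  by rewrite rs1 mul1r.
have kn : cnorm (rscal s * k) <= s.
  apply: (@cnorm_sqD _ h) => //.
  - by rewrite starM star_rs sk rs_comm.
  - by rewrite rs_mulC -mulrA hk.
  - exact: ltW.
  rewrite rs_sqr kk mulrBr mulr1 (mulrA (rscal (s ^+ 2))) -rsM divff//.
  by rewrite rs1 mul1r subrK.
apply: le_trans (cnormM _ _) _; rewrite expr2.
by rewrite ler_pM ?cnorm_ge0.
Qed.

(** The square roots a and b of p and q commute, so p q = (a b)^2 is the square of a selfadjoint
    element. *)
Lemma posM p q : pos p -> pos q -> p * q = q * p -> pos (p * q).
Proof.
move=> /pos_sqrt[a [sa <- ac]] /pos_sqrt[b [sb <- bc]] pq.
have ab : a * b = b * a by apply/esym/bc/esym/ac.
have -> : a * a * (b * b) = (a * b) * (a * b).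
  by rewrite -!mulrA; congr (_ * _); rewrite !mulrA ab.
by apply: pos_sqr; rewrite starM sa sb ab.
Qed.

(** If a^2 = t - h and b^2 = t + h, then (a b)^2 = t^2 - h^2, and [cnorm_sqD] applies to h and a
    b. *)
Lemma pos_cnorm_le h t : 0 <= t -> pos (rscal t - h) -> pos (rscal t + h) ->
  cnorm h <= t.
Proof.
move=> t0 pm pp.
have sh : star h = h.
  by have [] := pp; rewrite starD star_rs => /addrI.
have [a [sa aa ac]] := pos_sqrt pm; have [b [sb bb bc]] := pos_sqrt pp.
have ah : a * h = h * a.
  by apply: ac; rewrite mulrBl mulrBr rs_comm.
have bh : b * h = h * b.
  by apply: bc; rewrite mulrDl mulrDr rs_comm.
have ab : a * b = b * a.
  by apply/esym/bc; rewrite mulrDl mulrDr rs_comm ah.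
apply: (@cnorm_sqD h (a * b)) => //.
- by rewrite starM sa sb ab.
- by rewrite -mulrA bh !mulrA ah.
have -> : a * b * (a * b) = a * a * (b * b).
  by rewrite -!mulrA; congr (_ * _); rewrite !mulrA ab.
rewrite aa bb mulrBl mulrDr mulrDr (rs_comm t h) -rsM -(expr2 t).
by rewrite addrKA addrC subrK.
Qed.

(** The bridge from order to norm used in all later estimates: |p| - h = (|p| - p) + (p - h) is
    positive, and likewise |p| + h. *)
Lemma cnorm_dominated h p : pos p -> pos (p - h) -> pos (p + h) ->
  cnorm h <= cnorm p.
Proof.
move=> [sp _] pm pp; have tp := pos_sub_norm sp (lexx _).
apply: pos_cnorm_le; rewrite ?cnorm_ge0//.
  by rewrite -(subrKA p); exact: posD.
by rewrite -[rscal _](subrK p) -addrA; exact: posD.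
Qed.

(* Put [T = |b|] and [h = T - b].  If [s = |h| > T], then [s - h = b + (s - T)] is
   positive and invertible, hence at least some [0 < e <= s]; also [- h <= 0 <= s - e],
   so [|h| <= s - e], a contradiction. *)
Lemma cpositive_pos b : cpositive b -> pos b.
Proof.
move=> [sb spec]; split=> //; set T := cnorm b.
exists T; first exact: cnorm_ge0.
set h := rscal T - b; set s := cnorm h; rewrite leNgt; apply/negP => Ts.
have sh : star h = h by rewrite starB star_rs sb.
have s0 : 0 < s by apply: le_lt_trans Ts; exact: cnorm_ge0.
have psh : pos (rscal s - h) := pos_sub_norm sh (lexx _).
have [r [r1 r2]] : exists r, r * (rscal s - h) = 1 /\ (rscal s - h) * r = 1.
  apply: contrapT => nr; have := spec ((T - s)%:C)%C; rewrite /spectrum /=.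
  have -> : b - ((T - s)%:C)%C%:A = rscal s - h.
    by rewrite -[X in b - X]/(rscal (T - s)) rsB /h !opprB addrCA addrC.
  by move=> /(_ nr); rewrite lecR subr_ge0 leNgt Ts.
have [q [sq qq qc]] := pos_sqrt psh.
have rc y : (rscal s - h) * y = y * (rscal s - h) -> r * y = y * r.
  move=> yc; rewrite -[in LHS](mulr1 y) -r2 (mulrA y) -yc -mulrA mulrA r1 mul1r.
  by [].
have rq : r * q = q * r by apply: rc; rewrite -qq mulrA.
have sr : star r = r.
  rewrite -[LHS]mulr1 -r2 mulrA.
  have -> : star r * (rscal s - h) = 1.
    by rewrite -star1 -[in RHS]r2 starM psh.1.
  by rewrite mul1r.
have pr : pos r.
  have -> : r = (r * q) * (r * q).
    by rewrite {2}rq mulrA -[r * q * q]mulrA qq r1 mul1r.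
  by apply: pos_sqr; rewrite starM sq sr rq.
(* The summand |r| makes C - r positive and the summand 1/s gives 1/C <= s. The lower bound for s -
   h is e = 1/C, because s - h - 1/C = (C - r) (s - h) / C. *)
pose C := cnorm r + s^-1.
have C0 : 0 < C by rewrite ltr_wpDl ?cnorm_ge0// invr_gt0.
have pC : pos (rscal C - r) by apply: pos_sub_norm; rewrite // lerDl invr_ge0 ltW.
have pe : pos (rscal (s - C^-1) - h).
  have -> : rscal (s - C^-1) - h = rscal C^-1 * ((rscal C - r) * (rscal s - h)).
    rewrite mulrBl r1 mulrBr mulr1 mulrA -rsM mulVf ?gt_eqF// rs1 mul1r rsB.
    by rewrite addrAC.
  apply: pos_scale; first by rewrite invr_ge0 ltW.
  by apply: posM => //; rewrite [LHS]mulrBl [RHS]mulrBr r1 r2 rs_comm.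
have sC : 0 <= s - C^-1.
  by rewrite subr_ge0 -[leRHS]invrK lef_pV2 ?posrE ?invr_gt0// lerDr cnorm_ge0.
have pe' : pos (rscal (s - C^-1) + h).
  rewrite /h addrA -addrA; apply: posD; first exact: pos_rs.
  by apply: pos_sub_norm => //; rewrite lexx.
have := pos_cnorm_le sC pe pe'; rewrite -/s.
by rewrite leNgt ltrBlDr ltrDl invr_gt0 C0.
Qed.

End CStarBasics.

(** * Expectation over words *)

Section WordExpectation.
Variables (R : realType) (B : cstarAlgType R) (I : finType) (b : I -> B).
Implicit Types (G H : seq I -> B) (w v : seq I) (x y : B) (i j k : I) (n m : nat).
Local Notation rs := (rscal B).

(* The noncommutative expectation of [G] over words of length [n] with
   independent letters of "probabilities" [b i]; for [G] depending only on the
   letter frequencies this is a Bernstein polynomial evaluated at [b]. *)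
Fixpoint wordE n G : B :=
  if n is n'.+1 then \sum_i b i * wordE n' (fun w => G (i :: w)) else G [::].

Definition freq i w : R := (count_mem i w)%:R / (size w)%:R.

Lemma eq_wordE n G H : (forall w, size w = n -> G w = H w) -> wordE n G = wordE n H.
Proof.
elim: n G H => [|n ih] G H GH /=; first exact: GH.
by apply: eq_bigr => i _; congr (_ * _); apply: ih => w wn; apply: GH; rewrite /= wn.
Qed.

Lemma wordED n G H : wordE n (fun w => G w + H w) = wordE n G + wordE n H.
Proof.
elim: n G H => [//|n ih] G H /=; rewrite -big_split /=.
by apply: eq_bigr => i _; rewrite ih mulrDr.
Qed.

Lemma wordEZ n c G : wordE n (fun w => c *: G w) = c *: wordE n G.
Proof.
elim: n G => [//|n ih] G /=; rewrite scaler_sumr.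
by apply: eq_bigr => i _; rewrite ih scalerAr.
Qed.

Lemma wordEN n G : wordE n (fun w => - G w) = - wordE n G.
Proof. by rewrite -scaleN1r -wordEZ; apply: eq_wordE => w _; rewrite scaleN1r. Qed.

Lemma wordEB n G H : wordE n (fun w => G w - H w) = wordE n G - wordE n H.
Proof. by rewrite wordED wordEN. Qed.

Lemma wordEM_rs n s G : wordE n (fun w => rs s * G w) = rs s * wordE n G.
Proof.
by rewrite /rs -scalerAl mul1r -wordEZ; apply: eq_wordE => w _; rewrite -scalerAl mul1r.
Qed.

Lemma wordEMr n x G : wordE n (fun w => G w * x) = wordE n G * x.
Proof.
elim: n G => [//|n ih] G /=; rewrite mulr_suml.
by apply: eq_bigr => i _; rewrite ih mulrA.
Qed.

Lemma wordE_sum n (J : Type) (r : seq J) (G : J -> seq I -> B) :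
  wordE n (fun w => \sum_(j <- r) G j w) = \sum_(j <- r) wordE n (G j).
Proof.
elim: r => [|j r ih].
  rewrite big_nil -[RHS](subrr (wordE n (fun=> 0))) -wordEB.
  by apply: eq_wordE => w _; rewrite big_nil subrr.
by rewrite big_cons -ih -wordED; apply: eq_wordE => w _; rewrite big_cons.
Qed.

Lemma wordE_comm n G y : (forall i, b i * y = y * b i) ->
  (forall w, G w * y = y * G w) -> wordE n G * y = y * wordE n G.
Proof.
move=> yb; elim: n G => [|n ih] G yG /=; first exact: yG.
rewrite mulr_suml mulr_sumr; apply: eq_bigr => i _.
by rewrite mulrA -yb -!mulrA ih.
Qed.

Hypothesis bpos : forall i, pos (b i).
Hypothesis bC : forall i j, b i * b j = b j * b i.
Hypothesis b1 : \sum_i b i = 1.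

Lemma wordE_cst n x : wordE n (fun=> x) = x.
Proof.
elim: n => [//|n ih] /=.
by under eq_bigr do rewrite ih; rewrite -mulr_suml b1 mul1r.
Qed.

(** Positivity of a product needs commuting factors, hence the condition that the values of [G]
    commute with all letters. *)
Lemma wordE_pos n G : (forall w, size w = n -> pos (G w)) ->
  (forall w i, G w * b i = b i * G w) -> pos (wordE n G).
Proof.
elim: n G => [|n ih] G Gpos Gb /=; first exact: Gpos.
apply: pos_sum => i; apply: posM => //.
  by apply: ih => // w wn; apply: Gpos; rewrite /= wn.
by rewrite wordE_comm.
Qed.

Lemma wordE_star n G : (forall w i, G w * b i = b i * G w) ->
  star (wordE n G) = wordE n (fun w => star (G w)).
Proof.
elim: n G => [//|n ih] G Gb /=; rewrite star_sum; apply: eq_bigr => i _.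
by rewrite -wordE_comm// starM (bpos i).1 ih.
Qed.

Lemma sum_delta i y : \sum_j b j * ((j == i)%:R * y) = b i * y.
Proof.
rewrite (bigD1 i)//= eqxx mul1r big1 ?addr0// => j /negbTE ->.
by rewrite mul0r mulr0.
Qed.

Lemma wordE_count n i : wordE n (fun w => (count_mem i w)%:R) = b i *+ n.
Proof.
elim: n => [//|n ih] /=.
transitivity (\sum_j (b j * ((j == i)%:R * 1) + b j * (b i *+ n))).
  apply: eq_bigr => j _; rewrite -mulrDr -ih mulr1; congr (_ * _).
  by under [LHS]eq_wordE do rewrite natrD; rewrite wordED wordE_cst.
by rewrite big_split/= sum_delta -mulr_suml b1 mulr1 mul1r mulrS.
Qed.

(** The product of counts counts pairs of positions: n diagonal pairs, which contribute only when i
    = k, and n (n - 1) pairs of distinct, independent positions, each contributing [b i * b k]. *)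
Lemma wordE_countM n i k : wordE n (fun w => (count_mem i w * count_mem k w)%:R) =
  b i *+ (i == k) *+ n + b i * b k *+ (n * n.-1).
Proof.
elim: n => [|n ih]; first by rewrite /= !mulr0n addr0.
rewrite [LHS]/=.
transitivity (\sum_j (b j * ((j == i)%:R * (i == k)%:R) +
    b j * ((j == i)%:R * (b k *+ n)) + b j * ((j == k)%:R * (b i *+ n)) +
    b j * (b i *+ (i == k) *+ n + b i * b k *+ (n * n.-1)))).
  apply: eq_bigr => j _; rewrite -!mulrDr -ih; congr (_ * _).
  under [LHS]eq_wordE => w _ do rewrite mulnDl !mulnDr !natrD !natrM.
  rewrite !wordED wordE_cst wordEMr wordE_count.
  under [X in _ + X + _]eq_wordE do rewrite -rs_nat.
  rewrite wordEM_rs wordE_count rs_nat; under [in RHS]eq_wordE do rewrite natrM.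
  rewrite [b i *+ n * _]commr_nat addrA [in RHS]mulrDr; congr (_ + _ + _ + _).
  by have [->|] := eqVneq j i; rewrite // !mul0r.
rewrite !big_split/= !sum_delta -!mulr_suml b1 mul1r mulr_natr !mulrnAr (bC k i).
(* The case n = 0 is split off because the predecessor is truncated. *)
have -> : (n.+1 * n = n + n + n * n.-1)%N by case: n {ih} => //= n; ring.
by rewrite mulrS !mulrnDr (AC (3*2) ((1*4)*(2*3*5))).
Qed.

Lemma rs_natV n x : (0 < n)%N -> rs n%:R^-1 * (x *+ n) = x.
Proof.
move=> n0; rewrite -(mulr_natl x) -rs_nat mulrA -rsM mulVf ?pnatr_eq0 -?lt0n//.
by rewrite rs1 mul1r.
Qed.

Lemma wordE_freq n i : (0 < n)%N -> wordE n (fun w => rs (freq i w)) = b i.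
Proof.
move=> n0; rewrite -[RHS](rs_natV _ n0) -wordE_count -wordEM_rs; apply: eq_wordE => w wn.
by rewrite /freq wn mulrC rsM rs_nat.
Qed.

Lemma wordE_freqM n i k : (0 < n)%N -> wordE n (fun w => rs (freq i w * freq k w)) =
  rs n%:R^-1 * (b i *+ (i == k) + b i * b k *+ n.-1).
Proof.
move=> n0; rewrite -[X in rs _ * X](rs_natV _ n0) mulrnDl -(mulrnA (b i * b k)).
rewrite (mulnC n.-1) -wordE_countM -!wordEM_rs; apply: eq_wordE => w wn.
rewrite -rs_nat natrM -!rsM; congr rs.
by rewrite /freq wn mulrACA [RHS]mulrA mulrC.
Qed.

Lemma wordE_freq_sqr n i : (0 < n)%N -> wordE n (fun w => rs (freq i w ^+ 2)) =
  b i * b i + rs n%:R^-1 * (b i - b i * b i).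
Proof.
move=> n0; under eq_wordE do rewrite expr2; rewrite wordE_freqM// eqxx mulr1n.
case: n n0 => // n _; rewrite [in LHS]/=.
rewrite -[X in X + rs _ * _](@rs_natV n.+1)// -mulrDr; congr (_ * _).
by rewrite mulrSr -addrA (addrC (b i * b i) (b i - _)) subrK addrC.
Qed.

(** The sum over i of the variances of the indicators that a letter equals i, whose mean is
    [b i]. *)
Definition total_variance : B := \sum_i (b i - b i * b i).

(** Chebyshev's variance computation, with the algebra element [b i] in the role of the mean of the
    frequency; it serves the uniqueness proof. *)
Lemma wordE_deviation n : (0 < n)%N ->
  wordE n (fun w => \sum_i (b i - rs (freq i w)) * (b i - rs (freq i w))) =
  rs n%:R^-1 * total_variance.
Proof.
move=> n0; rewrite wordE_sum mulr_sumr; apply: eq_bigr => i _.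
transitivity (wordE n (fun w => b i * b i - rs (freq i w) * (b i *+ 2)
   + rs (freq i w ^+ 2))).
  apply: eq_wordE => w _; rewrite mulrBl !mulrBr -(rs_comm _ (b i)) -rsM.
  by rewrite opprB mulr2n mulrDr opprD expr2 (AC (2*2) ((1*(2*4))*3)).
rewrite wordED wordEB wordE_cst wordEMr wordE_freq// wordE_freq_sqr// mulr2n (mulrDr (b i)) opprD.
by rewrite (AC ((1*2)*2) ((1*2)*(4*3)*5)) /= !subrr !add0r.
Qed.

(** Expectation over two independent words. It brings averages over words of different lengths, and
    products of averages, under one sum where they can be compared pointwise. *)
Definition wordE2 n m (g : seq I -> seq I -> B) : B := wordE n (fun w => wordE m (g w)).

Definition freq_dist2 w v : R := \sum_i (freq i w - freq i v) ^+ 2.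

(** The two frequencies are independent with the same mean, so the variance of their difference is
    the sum of their variances. *)
Lemma wordE2_dist2 n m : (0 < n)%N -> (0 < m)%N ->
  wordE2 n m (fun w v => rs (freq_dist2 w v)) = rs (n%:R^-1 + m%:R^-1) * total_variance.
Proof.
move=> n0 m0; rewrite /wordE2 /freq_dist2.
under eq_wordE do under eq_wordE do rewrite rs_sum.
under eq_wordE do rewrite wordE_sum.
rewrite wordE_sum mulr_sumr; apply: eq_bigr => i _.
transitivity (wordE n (fun w => rs (freq i w ^+ 2) - rs (freq i w) * (b i *+ 2)
   + (b i * b i + rs m%:R^-1 * (b i - b i * b i)))).
  apply: eq_wordE => w _; rewrite -wordE_freq_sqr// -[in RHS](wordE_freq i m0).
  rewrite -mulr_natl -rs_nat mulrA -rsM -wordEM_rs -(wordE_cst m (rs (freq i w ^+ 2))).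
  rewrite -wordEB -wordED; apply: eq_wordE => v _; rewrite -!(rsM, rsB, rsD).
  by congr rs; ring.
rewrite wordED wordEB wordE_cst wordEMr wordE_freq// wordE_freq_sqr// mulr2n (mulrDr (b i)) opprD.
by rewrite (AC ((2*2)*2) (((1*3)*(5*4))*(2*6))) /= !subrr !add0r -mulrDl -rsD.
Qed.

Lemma wordE2D n m g h : wordE2 n m (fun w v => g w v + h w v) = wordE2 n m g + wordE2 n m h.
Proof. by rewrite /wordE2 -wordED; apply: eq_wordE => w _; rewrite wordED. Qed.

Lemma wordE2B n m g h : wordE2 n m (fun w v => g w v - h w v) = wordE2 n m g - wordE2 n m h.
Proof. by rewrite /wordE2 -wordEB; apply: eq_wordE => w _; rewrite wordEB. Qed.

Lemma wordE2Z n m c g : wordE2 n m (fun w v => c *: g w v) = c *: wordE2 n m g.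
Proof. by rewrite /wordE2 -wordEZ; apply: eq_wordE => w _; rewrite wordEZ. Qed.

Lemma eq_wordE2 n m g h : (forall w v, size w = n -> size v = m -> g w v = h w v) ->
  wordE2 n m g = wordE2 n m h.
Proof. by move=> gh; apply: eq_wordE => w wn; apply: eq_wordE => v; exact: gh. Qed.

Lemma wordE2_pos n m (q : seq I -> seq I -> R) :
  (forall w v, size w = n -> size v = m -> 0 <= q w v) ->
  pos (wordE2 n m (fun w v => rs (q w v))).
Proof.
move=> q0; apply: wordE_pos => [w wn|w i]; last by apply: wordE_comm => // v; rewrite rs_comm.
apply: wordE_pos => [v vm|v i]; last exact: rs_comm.
by apply: pos_rs; exact: q0.
Qed.

(** The expectation preserves positivity, so the pointwise bounds -q <= f <= q become order bounds
    in [B], and [cnorm_dominated] turns them into a norm bound. *)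
Lemma cnorm_wordE2_real n m (f q : seq I -> seq I -> R) :
  (forall w v, size w = n -> size v = m -> `|f w v| <= q w v) ->
  cnorm (wordE2 n m (fun w v => rs (f w v))) <= cnorm (wordE2 n m (fun w v => rs (q w v))).
Proof.
move=> fq; apply: cnorm_dominated.
- by apply: wordE2_pos => w v wn vm; apply: le_trans (fq w v wn vm).
- rewrite -wordE2B; under eq_wordE2 do rewrite -rsB; apply: wordE2_pos => w v wn vm.
  by rewrite subr_ge0 (le_trans _ (fq w v wn vm))// ler_norm.
- rewrite -wordE2D; under eq_wordE2 do rewrite -rsD; apply: wordE2_pos => w v wn vm.
  by move: (fq w v wn vm); rewrite ler_norml addrC -lerBlDr sub0r => /andP[].
Qed.

Lemma complex_scalar (z : R[i]) :
  z%:A = rs (complex.Re z) + 'i *: rs (complex.Im z) :> B.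
Proof.
by rewrite /rs scalerA -scalerDl; congr (_ *: _); rewrite {1}(complexE z).
Qed.

(** The order only controls selfadjoint elements; treating real and imaginary parts separately costs
    the factor 2. *)
Lemma cnorm_wordE2 n m (f : seq I -> seq I -> R[i]) (q : seq I -> seq I -> R) :
  (forall w v, size w = n -> size v = m -> Normc.normc (f w v) <= q w v) ->
  cnorm (wordE2 n m (fun w v => (f w v)%:A)) <=
  2 * cnorm (wordE2 n m (fun w v => rs (q w v))).
Proof.
move=> fq; under eq_wordE2 do rewrite complex_scalar.
rewrite wordE2D wordE2Z; apply: le_trans (cnormD _ _) _; rewrite cnormZ.
have -> : Normc.normc 'i = 1 :> R by rewrite /= expr0n expr1n add0r sqrtr1.
rewrite mul1r [2 * _]mulr_natl mulr2n; apply: lerD; apply: cnorm_wordE2_real => w v wn vm.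
  exact: le_trans (normc_Re _) (fq w v wn vm).
exact: le_trans (normc_Im _) (fq w v wn vm).
Qed.

Lemma wordE2_mul n m (f g : seq I -> R[i]) :
  wordE2 n m (fun w v => (f w * g v)%:A) =
  wordE n (fun w => (f w)%:A) * wordE m (fun v => (g v)%:A).
Proof.
rewrite -wordEMr; apply: eq_wordE => w _; rewrite -scalerAl mul1r -wordEZ.
by apply: eq_wordE => v _; rewrite scalerA.
Qed.

Lemma wordE2_left n m G : wordE2 n m (fun w _ => G w) = wordE n G.
Proof. by apply: eq_wordE => w _; exact: wordE_cst. Qed.

Lemma wordE2_right n m G : wordE2 n m (fun _ v => G v) = wordE m G.
Proof. exact: wordE_cst. Qed.

End WordExpectation.

(** * Join coordinates on the sphere *)

Section RealContinuity.
Variables (R : realType) (X : topologicalType).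
Implicit Types f g : X -> R.

Lemma continuousR_mul f g : continuous f -> continuous g ->
  continuous (fun x => f x * g x).
Proof. by move=> cf cg x; apply: cvgM; [exact: cf|exact: cg]. Qed.

Lemma continuousR_sub f g : continuous f -> continuous g ->
  continuous (fun x => f x - g x).
Proof. by move=> cf cg x; apply: cvgB; [exact: cf|exact: cg]. Qed.

Lemma continuousR_inv f : (forall x, f x != 0) -> continuous f ->
  continuous (fun x => (f x)^-1).
Proof. by move=> f0 cf x; apply: cvgV => //; exact: cf. Qed.

Lemma continuousR_norm f : continuous f -> continuous (fun x => `|f x|).
Proof. by move=> cf x; apply: cvg_norm; exact: cf. Qed.

Lemma continuousR_max0 f : continuous f -> continuous (fun x => Num.max 0 (f x)).
Proof.
move=> cf x; apply: (@continuous_max R X (fun=> 0) f); last exact: cf.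
exact: cst_continuous.
Qed.

Lemma continuousR_sum (J : finType) (F : J -> X -> R) :
  (forall j, continuous (F j)) -> continuous (fun x => \sum_j F j x).
Proof.
move=> Fc; have addc : continuous (fun z : R * R => z.1 + z.2).
  by move=> z; exact: add_continuous.
by apply: (@continuous_big R J +%R 0 xpredT addc X (index_enum _) F) => j _.
Qed.

End RealContinuity.

Section JoinCoordinates.
Variables (R : realType) (d : nat).
Local Notation S := (Sphere R d).
Local Notation I := ('Z_2 * 'I_d.+1)%type.
Implicit Types (x y : S) (i : I).

Definition jcoord i x : R := join_coordinate i.1 i.2 x.
Local Notation crd x j := ((\val x : 'rV[R]_d.+1) ord0 j).
Local Notation l1 x := (\sum_(k < d.+1) `|crd x k|).

Lemma l1_gt0 x : 0 < l1 x.
Proof.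
rewrite lt_def sumr_ge0 ?andbT// psumr_eq0//; apply/negP => /allP h.
have := sphereP x; rewrite /sphere /= big1 => [/eqP|j _].
  by rewrite eq_sym oner_eq0.
by have := h j (mem_index_enum j); rewrite normr_eq0 => /eqP ->; rewrite expr0n.
Qed.

Lemma sum_Z2 (V : nmodType) (F : 'Z_2 -> V) : \sum_g F g = F 0 + F 1.
Proof.
by rewrite !big_ord_recl big_ord0 addr0; congr (F _ + F _); exact: val_inj.
Qed.

Lemma Z2P (P : 'Z_2 -> Prop) : P 0 -> P 1 -> forall g, P g.
Proof.
move=> P0 P1 [[|[|//]] h]; first by have -> : Ordinal h = 0 by exact: val_inj.
by have -> : Ordinal h = 1 by exact: val_inj.
Qed.

Lemma jcoord0 j x : jcoord (0, j) x = Num.max 0 (crd x j) / l1 x.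
Proof. by rewrite /jcoord /join_coordinate /= expr0 mul1r. Qed.

Lemma jcoord1 j x : jcoord (1, j) x = Num.max 0 (- crd x j) / l1 x.
Proof. by rewrite /jcoord /join_coordinate /= expr1 mulN1r. Qed.

Lemma jcoord_ge0 i x : 0 <= jcoord i x.
Proof. by rewrite /jcoord /join_coordinate divr_ge0 ?le_max ?lexx// sumr_ge0. Qed.

Lemma maxr0D (t : R) : Num.max 0 t + Num.max 0 (- t) = `|t|.
Proof.
by case: (lerP 0 t) => h; [rewrite max_l ?addr0 ?oppr_le0// ger0_norm
  |rewrite max_r ?add0r ?oppr_ge0 ?ltW// ltr0_norm].
Qed.

Lemma maxr0B (t : R) : Num.max 0 t - Num.max 0 (- t) = t.
Proof.
by case: (lerP 0 t) => h; [rewrite max_l ?subr0 ?oppr_le0//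
  |rewrite max_r ?sub0r ?opprK ?oppr_ge0 ?ltW].
Qed.

Lemma sum_pair (V : nmodType) (F : I -> V) :
  \sum_i F i = \sum_(j < d.+1) (F (0, j) + F (1, j)).
Proof.
rewrite big_split/=.
by have := sum_Z2 (fun g => \sum_j F (g, j)); rewrite pair_bigA => <-;
  apply: eq_bigr => -[].
Qed.

Lemma sum_jcoord x : \sum_i jcoord i x = 1.
Proof.
rewrite sum_pair; under eq_bigr do rewrite jcoord0 jcoord1 -mulrDl maxr0D.
by rewrite -mulr_suml divff// gt_eqF// l1_gt0.
Qed.

Lemma jcoord_orth j x : jcoord (0, j) x * jcoord (1, j) x = 0.
Proof.
rewrite jcoord0 jcoord1; case: (lerP 0 (crd x j)) => h; last by rewrite !mul0r.
by rewrite [Num.max 0 (- _)]max_l ?oppr_le0// mul0r mulr0.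
Qed.

Lemma crd_jcoord j x : crd x j = l1 x * (jcoord (0, j) x - jcoord (1, j) x).
Proof.
by rewrite jcoord0 jcoord1 -mulrBl maxr0B mulrC divfK// gt_eqF// l1_gt0.
Qed.

(** Join coordinates determine a point up to a positive factor, the ratio of l1 norms, and the
    Euclidean norm 1 forces this factor to be 1. *)
Lemma jcoord_inj x y : (forall i, jcoord i x = jcoord i y) -> x = y.
Proof.
move=> xy; pose t := l1 x / l1 y.
have t0 : 0 < t by rewrite divr_gt0 ?l1_gt0.
have xty j : crd x j = t * crd y j.
  by rewrite !crd_jcoord !xy mulrA /t divfK// gt_eqF// l1_gt0.
have t1 : t = 1.
  apply/eqP; rewrite -(@eqrXn2 _ 2)// ?ltW// expr1n; apply/eqP.
  rewrite -[RHS](sphereP x) -[LHS]mulr1 -[in LHS](sphereP y) mulr_sumr.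
  by apply: eq_bigr => j _; rewrite -exprMn -xty.
by apply/val_inj/rowP => j; rewrite xty t1 mul1r.
Qed.

(** Put v_j = mu(0,j) - mu(1,j). Orthogonality makes the two weights the positive and negative parts
    of v_j, so v has l1 norm 1; its radial projection v / N to the sphere is the point sought. *)
Lemma jcoord_surj (mu : I -> R) : (forall i, 0 <= mu i) -> \sum_i mu i = 1 ->
  (forall j, mu (0, j) * mu (1, j) = 0) -> exists x, forall i, jcoord i x = mu i.
Proof.
move=> mu0 mu1 muo; pose v j := mu (0, j) - mu (1, j).
have mu_max j : mu (0, j) = Num.max 0 (v j) /\ mu (1, j) = Num.max 0 (- v j).
  rewrite /v opprB; move/eqP: (muo j); rewrite mulf_eq0 => /orP[]/eqP ->.
    by rewrite subr0 sub0r max_l ?oppr_le0// max_r.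
  by rewrite subr0 sub0r max_r// max_l// oppr_le0.
have v1 : \sum_j `|v j| = 1.
  rewrite -mu1 sum_pair; apply: eq_bigr => j _.
  by rewrite (mu_max j).1 (mu_max j).2 maxr0D.
pose N := Num.sqrt (\sum_j v j ^+ 2).
have N0 : 0 < N.
  rewrite sqrtr_gt0 lt_def sumr_ge0 ?andbT => [|j _]; last exact: sqr_ge0.
  rewrite psumr_eq0 => [|j _]; last exact: sqr_ge0.
  apply/negP => /allP h; move: v1; rewrite big1 => [/eqP|j _].
    by rewrite eq_sym oner_eq0.
  by have := h j (mem_index_enum j); rewrite sqrf_eq0 => /eqP ->; rewrite normr0.
have Nn0 : N != 0 by rewrite gt_eqF.
have hx : sphere R d (\row_j (v j / N)).
  rewrite /sphere /=; under eq_bigr do rewrite mxE expr_div_n.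
  rewrite -mulr_suml -[X in X / _]sqr_sqrtr ?divff ?sqrf_eq0//.
  by apply: sumr_ge0 => j _; exact: sqr_ge0.
exists (to_sphere hx).
have l1E : l1 (to_sphere hx) = N^-1.
  under eq_bigr do rewrite /= mxE normrM [`|_^-1|]gtr0_norm ?invr_gt0//.
  by rewrite -mulr_suml v1 mul1r.
have maxN (t : R) : Num.max 0 (t / N) / N^-1 = Num.max 0 t.
  by rewrite -{1}[0](mul0r N^-1) -maxr_pMl ?invr_ge0 ?ltW// mulfK// invr_eq0.
case=> g j; move: g; apply: Z2P; rewrite ?jcoord0 ?jcoord1 l1E /= mxE -?mulNr maxN.
  by rewrite -(mu_max j).1.
by rewrite -(mu_max j).2.
Qed.

Lemma crd_antipode x j : crd (antipode x) j = - crd x j.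
Proof. by rewrite /= mxE. Qed.

(** The antipode preserves the l1 norm and exchanges the positive and negative parts of each
    coordinate. *)
Lemma jcoord_act g h j x : jcoord (h, j) (sphere_act (- g) x) = jcoord (g + h, j) x.
Proof.
have l1A : l1 (antipode x) = l1 x.
  by apply: eq_bigr => k _; rewrite crd_antipode normrN.
have act1 : sphere_act (- 1) x = antipode x by [].
have act0 : sphere_act (- 0) x = x by [].
move: g; apply: Z2P; first by rewrite act0 add0r.
rewrite act1; move: h; apply: Z2P.
  by rewrite addr0 jcoord0 jcoord1 l1A crd_antipode.
have -> : 1 + 1 = 0 :> 'Z_2 by exact: val_inj.
by rewrite jcoord0 jcoord1 l1A crd_antipode opprK.
Qed.

Lemma jcoord_continuous i : continuous (jcoord i).
Proof.
apply: continuousR_mul.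
  apply: continuousR_max0; apply: continuousR_mul.
    exact: cst_continuous.
  exact: sphere_coord_continuous.
apply: continuousR_inv => [x|]; first by rewrite gt_eqF// l1_gt0.
apply: continuousR_sum => k; apply: continuousR_norm.
exact: sphere_coord_continuous.
Qed.

(** The squared distance is chosen since its expectation over words involves only second moments. *)
Definition jcoord_dist2 x y : R := \sum_i (jcoord i x - jcoord i y) ^+ 2.

(** A quadratic modulus of continuity. On the compact set of pairs with |F x - F y| >= e the points
    differ, so [jcoord_dist2] has a positive minimum there; C is twice the norm of F divided by it,
    or 0 if the set is empty. *)
Lemma modulus_jcoord (F : CSphere R d) (e : R) : 0 < e ->
  exists2 C : R, 0 <= C &
    forall x y, Normc.normc (F x - F y) <= e + C * jcoord_dist2 x y.
Proof.
move=> e0.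
pose D (z : S * S) := jcoord_dist2 z.1 z.2.
pose N (z : S * S) := Normc.normc (F z.1 - F z.2).
have D_ge0 z : 0 <= D z by apply: sumr_ge0 => i _; exact: sqr_ge0.
have cD : continuous D.
  have cj (p : S * S -> S) i : continuous p -> continuous (fun z => jcoord i (p z)).
    by move=> cp z; apply: continuous_comp; [exact: cp|exact: jcoord_continuous].
  apply: continuousR_sum => i; under eq_fun do rewrite expr2.
  by apply: continuousR_mul; apply: continuousR_sub; apply: cj => z;
    [exact: cvg_fst|exact: cvg_snd|exact: cvg_fst|exact: cvg_snd].
have cN : continuous N.
  apply: (@cts_normc R (S * S)%type (fun z => F z.1 - F z.2)).
  apply: cts_add; last apply: cts_opp.
    by move=> z; apply: (@continuous_comp (S * S)%type S R[i]^o fst F);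
      [exact: cvg_fst|exact: cs_continuous].
  by move=> z; apply: (@continuous_comp (S * S)%type S R[i]^o snd F);
    [exact: cvg_snd|exact: cs_continuous].
pose K := [set z | e <= N z].
have cK : compact K.
  apply: (@subclosed_compact _ _ [set: S * S]) => //.
    apply: (@preimage_closed _ _ N [set t | e <= t]); last exact: closed_ge.
    by move=> z _; exact: cN.
  by rewrite -setXTT; apply: compact_setX; exact: Sphere_compact.
have [K0|/set0P Kn0] := eqVneq K set0.
  exists 0 => // x y; rewrite mul0r addr0 leNgt; apply/negP => /ltW h.
  by have : K (x, y) by []; rewrite K0.
have [z zK zmin] := compact_EVT_min Kn0 cK (continuous_subspaceT cD).
have Dz : 0 < D z.
  rewrite lt_def D_ge0 andbT; apply/negP => /eqP Dz0.
  have zz : z.1 = z.2.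
    apply: jcoord_inj => i; apply/eqP; rewrite -subr_eq0 -sqrf_eq0.
    move/eqP: Dz0; rewrite psumr_eq0 => [/allP/(_ i (mem_index_enum i))//|k _].
    exact: sqr_ge0.
  move: zK; rewrite inE /K /N /= zz subrr Normc.normc0.
  by rewrite leNgt e0.
have M0 : 0 <= cs_norm F + cs_norm F by rewrite addr_ge0 ?cs_norm_ge0.
exists ((cs_norm F + cs_norm F) / D z); first by apply: divr_ge0 => //; exact: ltW.
move=> x y; have [exy|/ltW xye] := leP e (N (x, y)); last first.
  apply: le_trans xye _; rewrite lerDl; apply: mulr_ge0; last exact: (D_ge0 (x, y)).
  by apply: divr_ge0 => //; exact: ltW.
have : Normc.normc (F x - F y) <= cs_norm F + cs_norm F.
  apply: le_trans (normc_triangle _ _) _; rewrite normc_opp.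
  by apply: lerD; exact: cs_norm_ub.
move/le_trans; apply; apply: (@le_trans _ _ ((cs_norm F + cs_norm F) / D z * D (x, y))).
  rewrite -mulrA ler_peMr// ler_pdivlMl// mulr1.
  by apply: zmin; rewrite inE.
by rewrite lerDr ltW.
Qed.

End JoinCoordinates.

(** * The join coordinates as generators of C(S^d) *)

Lemma cts_inv (R : realType) (X : topologicalType) (f : X -> R[i]^o) :
  (forall x, f x != 0) -> continuous f -> continuous (fun x => (f x)^-1 : R[i]^o).
Proof. by move=> f0 cf x; apply: (@cvgV R[i]); [exact: f0|exact: cf]. Qed.

Section SphereGenerators.
Variables (R : realType) (d : nat).
Local Notation S := (Sphere R d).
Local Notation C := R[i]^o.
Local Notation T := (CSphere R d).
Local Notation I := ('Z_2 * 'I_d.+1)%type.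

Lemma jcoordC_continuous (i : I) : continuous (fun x : S => ((jcoord i x)%:C)%C : C).
Proof.
apply/complex_continuousP => x e e0.
have /cvgrPdist_lt/(_ e e0) := @jcoord_continuous R d i x.
by apply: filterS => y; rewrite -rmorphB normc_real.
Qed.

Definition join_gen (i : I) : T := cs_of (@jcoordC_continuous i).

(** If l is not a nonnegative real, f - l vanishes nowhere, and its pointwise inverse is
    continuous. *)
Lemma cs_cpositive (f : T) : (forall x, 0 <= f x) -> cpositive f.
Proof.
move=> f0; split.
  apply: cs_ext => x; change ((f x)^* = f x).
  by apply/conj_Creal/ger0_real.
move=> l; apply: contraPP => l0; rewrite /spectrum /=; apply; apply: contrapT => nx.
have fl x : f x - l != 0.
  by rewrite subr_eq0; apply/eqP => fxl; apply: l0; rewrite -fxl.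
have gc : continuous (fun x : S => (f x - l)^-1 : C).
  apply: cts_inv => //.
  exact: cts_add (@cs_continuous _ _ f) (cts_opp (@cst_continuous S C l)).
apply: nx; exists (cs_of gc); split; apply: cs_ext => x.
  change ((f x - l)^-1 * (f x - l * 1) = 1).
  by rewrite mulr1 mulVf.
change ((f x - l * 1) * (f x - l)^-1 = 1).
by rewrite mulr1 mulfV.
Qed.

Lemma cs_sum (J : Type) (r : seq J) (F : J -> T) x :
  (\sum_(j <- r) F j) x = \sum_(j <- r) F j x.
Proof.
by elim: r => [|j r ih]; rewrite ?big_nil// !big_cons -ih.
Qed.

Lemma jcoord_le1 (i : I) (x : S) : jcoord i x <= 1.
Proof.
rewrite -(sum_jcoord x) (bigD1 i)//= lerDl sumr_ge0// => j _; exact: jcoord_ge0.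
Qed.

Lemma join_gen_relations : relations (fun g j => join_gen (g, j)).
Proof.
split.
- move=> g j; split; apply: cs_cpositive => x.
    change (0 <= ((jcoord (g, j) x)%:C)%C - 0); rewrite subr0 lecR; exact: jcoord_ge0.
  change (0 <= 1 - ((jcoord (g, j) x)%:C)%C).
  by rewrite subr_ge0 -(rmorph1 (real_complex R)) lecR jcoord_le1.
- by move=> g k j l; rewrite mulrC subrr.
- move=> g h j gh; apply: cs_ext => x.
  change (((jcoord (g, j) x)%:C)%C * ((jcoord (h, j) x)%:C)%C = 0).
  rewrite -rmorphM; suff -> : jcoord (g, j) x * jcoord (h, j) x = 0 by rewrite rmorph0.
  move: g h gh; apply: Z2P; apply: Z2P => // _; first exact: jcoord_orth.
  by rewrite mulrC jcoord_orth.
- rewrite pair_bigA; apply: cs_ext => x; rewrite cs_sum.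
  transitivity ((\sum_i jcoord i x)%:C)%C; last by rewrite sum_jcoord.
  by rewrite rmorph_sum; apply: eq_bigr => -[].
Qed.

End SphereGenerators.

(** * Universality of the join coordinates *)

Section Universality.
Variables (R : realType) (d : nat).
Local Notation S := (Sphere R d).
Local Notation T := (CSphere R d).
Local Notation I := ('Z_2 * 'I_d.+1)%type.
Local Notation normc := (@Normc.normc R).

(* A word with a clash, i.e. containing both (0, j) and (1, j), is killed by the
   generators.  Instead of being discarded it is majorized by its number of
   clashes, whose expectation vanishes. *)
Definition clashes (w : seq I) : nat :=
  \sum_(j < d.+1) count_mem (0%R : 'Z_2, j) w * count_mem (1%R : 'Z_2, j) w.

Lemma sum_freq (w : seq I) : (0 < size w)%N -> \sum_i freq R i w = 1.
Proof.
move=> w0; rewrite -mulr_suml -natr_sum.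
suff -> : (\sum_i count_mem i w = size w)%N by rewrite divff// pnatr_eq0 -lt0n.
elim: w {w0} => [|i w ih] /=; first by rewrite big1.
rewrite big_split/= ih (bigD1 i)//= eqxx big1 ?addn0// => j.
by rewrite eq_sym => /negbTE ->.
Qed.

Lemma freq_ge0 (i : I) w : 0 <= freq R i w.
Proof. by rewrite /freq divr_ge0. Qed.

Lemma freq_le1 (i : I) w : (0 < size w)%N -> freq R i w <= 1.
Proof.
move=> w0; rewrite -(sum_freq w0) (bigD1 i)//= lerDl sumr_ge0// => j _.
exact: freq_ge0.
Qed.

(** The conditions on w stand after the existential so that choice yields a total function; empty
    words and words with clashes get an arbitrary default point. *)
Lemma word_point_exists (w : seq I) : exists x : S,
  (0 < size w)%N -> clashes w = 0%N -> forall i, jcoord i x = freq R i w.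
Proof.
have x0 : S := to_sphere (sphere_nonempty R d).
have [w0|] := boolP (0 < size w)%N; last by exists x0.
have [/eqP|] := eqVneq (clashes w) 0%N; last by move=> /eqP cw; exists x0.
rewrite sum_nat_eq0 => /forallP cw.
have [|||x xw] := @jcoord_surj R d (fun i => freq R i w).
- by move=> i; exact: freq_ge0.
- exact: sum_freq.
- move=> j; rewrite /freq mulf_div -natrM.
  by have /= /eqP -> := cw j; rewrite mul0r.
by exists x => _ _; exact: xw.
Qed.

Definition word_point : seq I -> S := projT1 (choice word_point_exists).

Lemma word_pointP w : (0 < size w)%N -> clashes w = 0%N ->
  forall i, jcoord i (word_point w) = freq R i w.
Proof. exact: (projT2 (choice word_point_exists)). Qed.

Lemma normc_sub_le (F : T) (x y : S) : normc (F x - F y) <= 2 * cs_norm F.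
Proof.
rewrite [2 * _]mulr_natl mulr2n; apply: le_trans (normc_triangle _ _) _.
by rewrite normc_opp; apply: lerD; exact: cs_norm_ub.
Qed.

(** * Existence: functional calculus for a family satisfying the relations *)

Section Relations.
Variables (B : cstarAlgType R) (b' : 'Z_2 -> 'I_d.+1 -> B).
Hypothesis b'P : relations b'.
Local Notation rs := (rscal B).

Definition generators (i : I) := b' i.1 i.2.
Local Notation b := generators.

Lemma relations_pos i : pos (b i).
Proof.
case: b'P => + _ _ _ => /(_ i.1 i.2)[]; rewrite /cle subr0 => h _.
exact: cpositive_pos.
Qed.

Lemma relations_comm i k : b i * b k = b k * b i.
Proof. by case: b'P => _ h _ _; apply/eqP; rewrite -subr_eq0 h. Qed.

Lemma relations_sum : \sum_i b i = 1.
Proof.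
case: b'P => _ _ _ <-; rewrite pair_bigA.
by apply: eq_bigr => -[].
Qed.

(** In the second moment of two distinct letters the diagonal term is absent, and the other contains
    b(0,j) b(1,j) = 0. *)
Lemma wordE_clashes n : wordE b n (fun w => rs (clashes w)%:R) = 0.
Proof.
under eq_wordE do rewrite rs_nat natr_sum.
rewrite wordE_sum big1// => j _; rewrite wordE_countM//; last exact: relations_sum;
  last exact: relations_comm.
have -> : ((0 : 'Z_2, j) == (1, j)) = false by rewrite xpair_eqE.
case: b'P => _ _ h _; rewrite /generators /= h// mulr0n !mul0rn addr0 //.
Qed.

Let V := total_variance b.

Lemma wordE2_clash_bound n m (e c k : R) : (0 < n)%N -> (0 < m)%N ->
  wordE2 b n m (fun w v => rs (e + c * freq_dist2 R w v
    + k * ((clashes w)%:R + (clashes v)%:R))) =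
  rs e + rs (c * (n%:R^-1 + m%:R^-1)) * V.
Proof.
move=> n0 m0; have E2c x : wordE2 b n m (fun _ _ => x) = x.
  by rewrite /wordE2 !wordE_cst //; exact: relations_sum.
under eq_wordE2 do rewrite !rsD !rsM rsD mulrDr.
rewrite !wordE2D E2c.
have E2rs t g : wordE2 b n m (fun w v => rs t * g w v) = rs t * wordE2 b n m g.
  by rewrite /wordE2 -wordEM_rs; apply: eq_wordE => w _; rewrite wordEM_rs.
rewrite !E2rs wordE2_dist2//; try exact: relations_comm; try exact: relations_sum.
rewrite (wordE2_left relations_sum) (wordE2_right relations_sum) !wordE_clashes.
rewrite mulr0 !addr0.
by rewrite [in RHS]rsM -mulrA.
Qed.

(** The central estimate, kept general in [h] for two uses: F x - F y gives the Cauchy property, F x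
    (G y - G x) gives multiplicativity. *)
Lemma wordE2_small (G : T) (M : R) (h : S -> S -> R[i]) : 0 <= M ->
  (forall x y, normc (h x y) <= M * normc (G x - G y)) ->
  forall e : R, 0 < e -> exists N, forall n m, (N < n)%N -> (N < m)%N ->
    cnorm (wordE2 b n m (fun w v => (h (word_point w) (word_point v))%:A)) <= e.
Proof.
(* The final bound is 2 (M dl + K/n + K/m) with K = M c |V|. Here M dl <= e/4, the summand 1
   allowing M = 0, and n, m > 8 K / e make each of the other terms at most e/8. *)
move=> M0 hG e e0; pose dl := e / (4 * (M + 1)).
have M1 : 0 < M + 1 by rewrite ltr_wpDl.
have dl0 : 0 < dl by rewrite divr_gt0// mulr_gt0.
have [c c0 hc] := modulus_jcoord G dl0.
pose K := M * c * cnorm V.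
have K0 : 0 <= K by rewrite !mulr_ge0 ?cnorm_ge0.
have hN : 8 * K / e < (Num.bound (8 * K / e))%:R.
  apply: archi_boundP; apply: divr_ge0; last exact: ltW.
  exact: mulr_ge0.
exists (Num.bound (8 * K / e)); set N := Num.bound _ in hN *.
move=> n m Nn Nm.
have n0 : (0 < n)%N by apply: leq_ltn_trans Nn.
have m0 : (0 < m)%N by apply: leq_ltn_trans Nm.
have Kle (p : nat) : (N < p)%N -> K * p%:R^-1 <= e / 8.
  move=> Np; have p0 : 0 < p%:R :> R by rewrite ltr0n (leq_ltn_trans _ Np).
  have : e * N%:R <= e * p%:R by rewrite ler_pM2l// ler_nat ltnW.
  by move: hN; rewrite ler_pdivrMr// ltr_pdivrMr// mulrC; lra.
apply: (@le_trans _ _ (2 * cnorm (wordE2 b n m (fun w v => rs (M * dl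
    + M * c * freq_dist2 R w v + M * (2 * cs_norm G) * ((clashes w)%:R + (clashes v)%:R)))))).
  apply: cnorm_wordE2; [exact: relations_pos|exact: relations_comm|].
  move=> w v wn vm; apply: le_trans (hG _ _) _.
  rewrite -!mulrA -!mulrDr; apply: ler_wpM2l => //.
  have d20 : 0 <= freq_dist2 R w v by apply: sumr_ge0 => i _; exact: sqr_ge0.
  have [/eqP|cl] := eqVneq (clashes w + clashes v)%N 0%N.
    rewrite addn_eq0 => /andP[/eqP cw /eqP cv].
    rewrite cw cv addr0 !mulr0 addr0.
    suff -> : freq_dist2 R w v = jcoord_dist2 (word_point w) (word_point v) by exact: hc.
    by apply: eq_bigr => i _; rewrite !word_pointP ?wn ?vm.
  (* With a clash the counts add up to at least 1, so the clash term alone dominates, whatever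
     default points were chosen. *)
  apply: le_trans (normc_sub_le _ _ _) _.
  rewrite -[leLHS]add0r; apply: lerD; first by apply: addr_ge0; [exact: ltW|exact: mulr_ge0].
  rewrite mulrA -natrD ler_peMr// ?mulr_ge0 ?cs_norm_ge0//.
  by rewrite ler1n lt0n.
rewrite wordE2_clash_bound//.
apply: (@le_trans _ _ (2 * (M * dl + K * n%:R^-1 + K * m%:R^-1))).
  rewrite ler_pM2l// -addrA; apply: le_trans (cnormD _ _) _; apply: lerD.
    by rewrite cnorm_rs ger0_norm// mulr_ge0// ltW.
  rewrite cnorm_rsM ger0_norm; last by rewrite !mulr_ge0// addr_ge0.
  by rewrite /K -mulrDr mulrAC.
have := Kle n Nn; have := Kle m Nm.
have : M * dl <= e / 4.
  rewrite /dl mulrA ler_pdivrMr ?mulr_gt0//.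
  have -> : e / 4 * (4 * (M + 1)) = e * (M + 1) by field.
  by rewrite mulrC ler_pM2l// lerDl.
lra.
Qed.

Definition bernstein (F : T) n : B := wordE b n (fun w => (F (word_point w))%:A).

Lemma bernstein_cvg (F : T) : exists l, ccvg (bernstein F) l.
Proof.
apply: ccvg_cauchy => e e0; have e2 : 0 < e / 2 by rewrite divr_gt0.
have [|N hN] := @wordE2_small F 1 (fun x y => F x - F y) ler01 _ _ e2.
  by move=> x y; rewrite mul1r.
exists N.+1 => n m Nn Nm; apply: le_lt_trans (_ : _ <= e / 2) _; last by lra.
apply: le_trans (hN n m Nn Nm); rewrite le_eqVlt; apply/orP; left; apply/eqP.
congr cnorm; rewrite /bernstein -(wordE2_left relations_sum n m).
rewrite -(wordE2_right relations_sum n m) -wordE2B.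
by apply: eq_wordE2 => w v _ _; rewrite scalerBl.
Qed.

Definition join_calculus (F : T) : B := sval (cid (bernstein_cvg F)).

Lemma join_calculusP (F : T) : ccvg (bernstein F) (join_calculus F).
Proof. exact: (svalP (cid (bernstein_cvg F))). Qed.

Lemma join_calculus_linear : linear join_calculus.
Proof.
move=> l F G; apply: (ccvg_unique (join_calculusP _)).
have := ccvgD (ccvgZ l (join_calculusP F)) (join_calculusP G).
congr ccvg; apply/funext => n; rewrite /bernstein -wordEZ -wordED; apply: eq_wordE => w _.
by rewrite scalerA -scalerDl.
Qed.

(** With x and y the points of two independent words of length n, the product of the approximants
    minus the approximant of the product is the expectation of F x (G y - G x), which tends to 0. *)
Lemma join_calculusM (F G : T) : join_calculus (F * G) = join_calculus F * join_calculus G.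
Proof.
apply/esym.
apply: (ccvg_eq (ccvgM (join_calculusP F) (join_calculusP G)) (join_calculusP _)).
apply: ccvgP => e e0.
have [|N hN] := @wordE2_small G (cs_norm F) (fun x y => F x * (G y - G x))
  (cs_norm_ge0 F) _ _ e0.
  move=> x y; rewrite Normc.normcM -[normc (G y - _)]normc_opp opprB.
  by rewrite ler_wpM2r ?normc_ge0 ?cs_norm_ub.
exists N.+1 => n Nn; apply: le_trans (hN n n Nn Nn).
rewrite le_eqVlt; apply/orP; left; apply/eqP; congr cnorm; rewrite subr0.
rewrite /bernstein -(wordE2_mul b) -[X in _ - X](wordE2_left relations_sum n n) -wordE2B.
by apply: eq_wordE2 => w v _ _; rewrite mulrBr scalerBl.
Qed.

Lemma join_calculus1 : join_calculus 1 = 1.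
Proof.
apply: (ccvg_unique (join_calculusP _)); have := ccvg_cst (1 : B).
congr ccvg; apply/funext => n; rewrite /bernstein -[LHS](wordE_cst relations_sum n).
by apply: eq_wordE => w _; rewrite scale1r.
Qed.

Lemma join_calculus_star (F : T) : join_calculus (star F) = star (join_calculus F).
Proof.
apply: (ccvg_unique (join_calculusP _)); have := ccvg_star (join_calculusP F).
congr ccvg; apply/funext => n; rewrite /bernstein (wordE_star relations_pos relations_comm).
  by apply: eq_wordE => w _; rewrite starZ star1.
by move=> w i; rewrite -scalerAl -scalerAr mul1r mulr1.
Qed.

(** The approximants are exact for n >= 1: on words without clashes the value is the frequency of i,
    of mean [b i]; elsewhere the error is at most 1, hence at most twice the number of clashes,
    whose expectation is 0. *)
Lemma join_calculus_gen i : join_calculus (join_gen R i) = b i.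
Proof.
apply: (ccvg_unique (join_calculusP _)); apply: ccvgP => e e0; exists 1%N => n n0.
suff -> : bernstein (join_gen R i) n = b i by rewrite subrr cnorm0 ltW.
apply/eqP; rewrite -subr_eq0; apply/eqP/cnorm_le0.
(* A dummy second word, of length 0, makes the norm bound for pairs of words applicable. *)
rewrite -(wordE_freq relations_sum i n0) /bernstein -(wordE2_left relations_sum n 0).
rewrite -[X in _ - X](wordE2_left relations_sum n 0) -wordE2B.
apply: (@le_trans _ _ (cnorm (wordE2 b n 0 (fun w _ => rs (2 * (clashes w)%:R))))).
  under eq_wordE2 do rewrite -rsB.
  apply: cnorm_wordE2_real; [exact: relations_pos|exact: relations_comm|].
  move=> w v wn _; have w0 : (0 < size w)%N by rewrite wn.
  have [cw|cw] := eqVneq (clashes w) 0%N.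
    by rewrite word_pointP// subrr normr0 cw mulr0.
  have : 1 <= (clashes w)%:R :> R by rewrite ler1n lt0n.
  have := jcoord_ge0 i (word_point w); have := jcoord_le1 i (word_point w).
  have := freq_ge0 i w; have := freq_le1 i w0.
  by rewrite ler_norml; lra.
under eq_wordE2 do rewrite rsM.
by rewrite (wordE2_left relations_sum) wordEM_rs wordE_clashes mulr0 cnorm0.
Qed.

Lemma join_calculus_star_hom : star_hom join_calculus.
Proof.
split; [exact: join_calculus_linear| |exact: join_calculus_star].
by split; [exact: join_calculus1|exact: join_calculusM].
Qed.

End Relations.

(** Positive elements are squares of selfadjoint ones, and morphisms preserve such squares. *)
Lemma hom_pos (A B : cstarAlgType R) (psi : A -> B) (p : A) :
  star_hom psi -> pos p -> pos (psi p).
Proof.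
move=> [_ [_ psiM] psis] /pos_sqrt[q [sq <- _]]; rewrite psiM.
by apply: pos_sqr; rewrite -psis sq.
Qed.

Lemma hom_scaleD (A B : cstarAlgType R) (psi : A -> B) : star_hom psi ->
  [/\ forall x y, psi (x + y) = psi x + psi y,
      forall x y, psi (x - y) = psi x - psi y,
      forall l x, psi (l *: x) = l *: psi x
    & forall l, psi l%:A = l%:A].
Proof.
move=> [lin [p1 _] _].
have D x y : psi (x + y) = psi x + psi y by have := lin 1 x y; rewrite !scale1r.
have p0 : psi 0 = 0 by apply: (addIr (psi 0)); rewrite -D !add0r.
have Z l x : psi (l *: x) = l *: psi x by have := lin l x 0; rewrite p0 !addr0.
split=> // [x y|l]; last by rewrite Z p1.
by rewrite D -scaleN1r Z scaleN1r.
Qed.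

Lemma hom_sum (A B : cstarAlgType R) (psi : A -> B) (J : Type) (r : seq J)
  (F : J -> A) : star_hom psi ->
  psi (\sum_(j <- r) F j) = \sum_(j <- r) psi (F j).
Proof.
move=> /hom_scaleD[D _ Z _]; apply: (big_morph _ D).
by rewrite -(scale0r (0 : A)) Z scale0r.
Qed.

(** * Uniqueness of the morphism out of C(S^d) *)

Section Uniqueness.
Variables (B : cstarAlgType R) (b' : 'Z_2 -> 'I_d.+1 -> B).
Hypothesis b'P : relations b'.
Variable psi : T -> B.
Hypothesis psi_hom : star_hom psi.
Hypothesis psi_gen : forall i, psi (join_gen R i) = generators b' i.
Local Notation b := (generators b').

(* For suitable [c] and [k] this dominates [F - F (word_point w)] in the order of
   [T], for every word [w]. *)
Let majorant (e c k : R) (w : seq I) : T :=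
  rscal T e + rscal T c * \sum_i (join_gen R i - rscal T (freq R i w)) *
    (join_gen R i - rscal T (freq R i w))
  + rscal T (k * (clashes w)%:R).

Lemma majorantE e c k w (x : S) : majorant e c k w x =
  ((e + c * \sum_i (jcoord i x - freq R i w) ^+ 2 + k * (clashes w)%:R)%:C)%C.
Proof.
have rsE t : rscal T t x = (t%:C)%C by exact: mulr1.
transitivity ((e%:C)%C + (c%:C)%C * (\sum_i (join_gen R i - rscal T (freq R i w))
    * (join_gen R i - rscal T (freq R i w)) : T) x + ((k * (clashes w)%:R)%:C)%C).
  by rewrite -!rsE.
rewrite cs_sum !rmorphD (rmorphM _ c); congr (_ + _ * _ + _).
rewrite rmorph_sum; apply: eq_bigr => i _; rewrite expr2 rmorphM rmorphB.
change ((((jcoord i x)%:C)%C - rscal T (freq R i w) x) *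
  (((jcoord i x)%:C)%C - rscal T (freq R i w) x) =
  (((jcoord i x)%:C)%C - ((freq R i w)%:C)%C) *
  (((jcoord i x)%:C)%C - ((freq R i w)%:C)%C)).
by rewrite rsE.
Qed.

Lemma psi_rs t : psi (rscal T t) = rscal B t.
Proof. by have [_ _ _] := hom_scaleD psi_hom; apply. Qed.

(** As [psi] sends generators to the [b i], the quadratic term becomes the one in [wordE_deviation],
    and the clash term has expectation 0. *)
Lemma psi_majorant e c k n : (0 < n)%N ->
  wordE b n (fun w => psi (majorant e c k w)) =
  rscal B e + rscal B c * (rscal B n%:R^-1 * total_variance b).
Proof.
move=> n0; have [_ [_ psiM] _] := psi_hom.
have [psiD psiB _ _] := hom_scaleD psi_hom.
transitivity (wordE b n (fun w => rscal B e +
  rscal B c * (\sum_i (b i - rscal B (freq R i w)) * (b i - rscal B (freq R i w))) +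
  rscal B k * rscal B (clashes w)%:R)).
  apply: eq_wordE => w _; rewrite /majorant !psiD.
  rewrite (psiM (rscal T c)) !psi_rs rsM (hom_sum _ _ psi_hom).
  by congr (_ + _ * _ + _); apply: eq_bigr => i _; rewrite psiM psiB psi_gen psi_rs.
rewrite !wordED !wordEM_rs wordE_clashes// mulr0 addr0 wordE_cst ?wordE_deviation//;
  [exact: relations_comm|exact: relations_sum|exact: relations_sum].
Qed.

(** For each word, F minus its value at the point of the word lies pointwise between minus and plus
    the majorant. Both [psi] and the expectation preserve positivity, so [cnorm_dominated] carries
    this over to [B]; F is selfadjoint so that the order applies. *)
Lemma psi_bernstein (F : T) (e : R) : star F = F -> 0 < e ->
  exists2 c : R, 0 <= c & forall n, (0 < n)%N ->
  cnorm (bernstein b' F n - psi F) <= e + c * n%:R^-1.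
Proof.
move=> sF e0; have [c c0 hc] := modulus_jcoord F e0.
have [_ [_ psiM] _] := psi_hom; have [psiD psiB _ psiA] := hom_scaleD psi_hom.
exists (c * cnorm (total_variance b)); first by rewrite mulr_ge0 ?cnorm_ge0.
move=> n n0; pose k := 2 * cs_norm F.
have k0 : 0 <= k by rewrite mulr_ge0 ?cs_norm_ge0.
have Freal x : F x = ((complex.Re (F x))%:C)%C.
  have : (F x)^* = F x by rewrite -[in RHS]sF.
  by case: (F x) => u v [/eqP]; rewrite eq_sym -addr_eq0 -mulr2n mulrn_eq0 /= => /eqP ->.
have maj w (x : S) : size w = n -> `|complex.Re (F x) - complex.Re (F (word_point w))| <=
    e + c * \sum_i (jcoord i x - freq R i w) ^+ 2 + k * (clashes w)%:R.
  move=> wn; rewrite -raddfB; apply: le_trans (normc_Re _) _.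
  have [cw|cw] := eqVneq (clashes w) 0%N.
    rewrite cw mulr0 addr0; apply: le_trans (hc _ _) _.
    rewrite lerD2l; apply: ler_wpM2l => //; apply: ler_sum => i _.
    by rewrite word_pointP ?wn.
  apply: le_trans (normc_sub_le _ _ _) _; rewrite -[leLHS]add0r; apply: lerD.
    apply: addr_ge0; first exact: ltW.
    by apply: mulr_ge0 => //; apply: sumr_ge0 => i _; exact: sqr_ge0.
  by rewrite ler_peMr// ler1n lt0n.
(* The letters are images of generators and C(S^d) is commutative; [wordE_pos] needs this
   commutation. *)
have psib x i : psi x * b i = b i * psi x.
  by rewrite -psi_gen -!psiM mulrC.
pose D w : T := F - (F (word_point w))%:A.
have Dx w x : D w x = ((complex.Re (F x) - complex.Re (F (word_point w)))%:C)%C.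
  transitivity (F x - F (word_point w) * 1) => //.
  by rewrite mulr1 rmorphB; congr (_ - _); exact: Freal.
have wordE_D : wordE b n (fun w => psi (D w)) = psi F - bernstein b' F n.
  rewrite -[psi F](wordE_cst (relations_sum b'P) n) -wordEB; apply: eq_wordE => w _.
  by rewrite psiB psiA.
have Epos (f : seq I -> T) : (forall w x, size w = n -> 0 <= f w x) ->
    pos (wordE b n (fun w => psi (f w))).
  move=> f0; apply: wordE_pos => [|||//]; [exact: relations_pos|exact: relations_comm|].
  by move=> w wn; apply: hom_pos => //; apply/cpositive_pos/cs_cpositive => x; exact: f0.
rewrite cnormBC -wordE_D; apply: le_trans (_ : _ <= cnorm (wordE b n (fun w =>
    psi (majorant e c k w)))) _.
  apply: cnorm_dominated.
  - apply: Epos => w x wn; rewrite majorantE lecR.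
    exact: le_trans (normr_ge0 _) (maj w x wn).
  - rewrite -wordEB; under eq_wordE do rewrite -psiB.
    apply: Epos => w x wn; change (0 <= majorant e c k w x - D w x).
    rewrite majorantE Dx -rmorphB lecR subr_ge0.
    exact: le_trans (ler_norm _) (maj w x wn).
  - rewrite -wordED; under eq_wordE do rewrite -psiD.
    apply: Epos => w x wn; change (0 <= majorant e c k w x + D w x).
    rewrite majorantE Dx -rmorphD lecR; have := maj w x wn.
    by rewrite ler_norml => /andP[+ _]; rewrite -subr_ge0 opprK addrC.
rewrite psi_majorant//; apply: le_trans (cnormD _ _) _.
by rewrite cnorm_rs gtr0_norm// lerD2l !cnorm_rsM !ger0_norm// mulrA mulrAC.
Qed.

Lemma psi_real (F : T) : star F = F -> psi F = join_calculus b'P F.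
Proof.
move=> sF; apply: (ccvg_unique _ (join_calculusP b'P F)); apply: ccvgP => e e0.
have e2 : 0 < e / 2 by rewrite divr_gt0.
have [c c0 hc] := psi_bernstein sF e2.
have hN : 2 * c / e < (Num.bound (2 * c / e))%:R.
  apply: archi_boundP; apply: divr_ge0; last exact: ltW.
  exact: mulr_ge0.
exists (Num.bound (2 * c / e)).+1; set N := Num.bound _ in hN * => n Nn.
have n0 : 0 < n%:R :> R by rewrite ltr0n (leq_trans _ Nn).
apply: le_trans (hc n _) _; first by rewrite -(ltr0n R).
have : e * N%:R <= e * n%:R by rewrite ler_pM2l// ler_nat ltnW.
move: hN; rewrite ltr_pdivrMr// -lerBrDl ler_pdivrMr//; lra.
Qed.

Lemma psi_join_calculus : psi =1 join_calculus b'P.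
Proof.
move=> F; have [psiD _ psiZ _] := hom_scaleD psi_hom.
have [phiD _ phiZ _] := hom_scaleD (join_calculus_star_hom b'P).
(* F1 and F2 are the real and imaginary parts of F, which reduces the claim to selfadjoint
   functions. *)
pose F1 := (2^-1 : R[i]) *: (F + star F).
pose F2 := (2^-1 : R[i]) *: ('i *: (star F - F)).
have ii : 'i * 'i = -1 :> R[i] by rewrite -expr2 sqrCi.
have FE : F = F1 + 'i *: F2.
  apply: cs_ext => x.
  change (F x = 2^-1 * (F x + (F x)^*) + 'i * (2^-1 * ('i * ((F x)^* - F x)))).
  rewrite !mulrA (mulrC 'i) -(mulrA 2^-1) ii; by field.
have half : (2^-1 : R[i])^* = 2^-1 by rewrite fmorphV rmorph_nat.
rewrite FE psiD (psiZ 'i) phiD (phiZ 'i) !psi_real//.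
  by rewrite starZ half starZ conjCi starB starK scaleNr -scalerN opprB.
by rewrite starZ half starD starK addrC.
Qed.

End Uniqueness.
End Universality.

(** * From universality of C(S^d) to the equivariant isomorphism *)

Section Transport.
Variables (R : realType) (d : nat).
Local Notation T := (CSphere R d).

Lemma sphere_universal :
  universal_for_relations (fun (g : 'Z_2) (j : 'I_d.+1) => join_gen R (g, j)).
Proof.
split; first exact: join_gen_relations.
move=> B b' b'P; exists (join_calculus b'P); split; first exact: join_calculus_star_hom.
  by move=> g j; exact: join_calculus_gen.
by move=> psi psi_hom psi_gen; apply: psi_join_calculus => // -[g j]; exact: psi_gen.
Qed.

Lemma star_hom_id (A : cstarAlgType R) : star_hom (@idfun A).
Proof. by split. Qed.

Lemma star_hom_comp (A B C : cstarAlgType R) (f : A -> B) (g : B -> C) :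
  star_hom f -> star_hom g -> star_hom (g \o f).
Proof.
move=> [fl [f1 fM] fs] [gl [g1 gM] gs]; split.
- by move=> l x y; rewrite /= fl gl.
- by split=> [|x y] /=; rewrite ?f1 ?g1// fM gM.
- by move=> x /=; rewrite fs gs.
Qed.

(** Both [chi] and the identity solve the universal problem for [f] itself. *)
Lemma universal_id (A : cstarAlgType R) (f : 'Z_2 -> 'I_d.+1 -> A) (chi : A -> A) :
  universal_for_relations f -> star_hom chi ->
  (forall g j, chi (f g j) = f g j) -> chi =1 id.
Proof.
move=> [fP /(_ A f fP)[eta [_ _ etaU]]] chi_hom chif x.
by rewrite (etaU chi)// -(etaU idfun)//; exact: star_hom_id.
Qed.

Lemma antipodal_gen (g h : 'Z_2) (j : 'I_d.+1) :
  antipodal_action g (join_gen R (h, j)) = join_gen R (g + h, j).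
Proof.
by apply: cs_ext => x; congr (_%:C)%C; exact: jcoord_act.
Qed.

End Transport.

(** The existence half keeps the second from being vacuous. The formula on generators expresses
    canonicity: by universality it determines [phi]. *)
Theorem lemma3p25 (R : realType) (d : nat) :
  (exists (A : cstarAlgType R) (f : 'Z_2 -> 'I_d.+1 -> A),
     universal_for_relations f) /\
  forall (A : cstarAlgType R) (f : 'Z_2 -> 'I_d.+1 -> A),
    universal_for_relations f ->
    exists alpha : 'Z_2 -> A -> A,
      [/\ generator_action f alpha,
          forall beta : 'Z_2 -> A -> A, generator_action f beta ->
            forall g, beta g =1 alpha g
        & exists phi : A -> CSphere R d,
            [/\ star_iso phi,
                equivariant alpha (@antipodal_action R d) phi
              & forall (g : 'Z_2) (j : 'I_d.+1) (x : Sphere R d),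
                  phi (f g j) x = (join_coordinate g j x)%:C%C]].
Proof.
have SU := sphere_universal R d.
split; first by exists (CSphere R d), (fun g j => join_gen R (g, j)).
move=> A f AU.
have [phi [phi_hom phi_f _]] := AU.2 _ _ SU.1.
have [psi [psi_hom psi_gen _]] := SU.2 _ _ AU.1.
have psiK : cancel phi psi.
  apply: (universal_id AU (star_hom_comp phi_hom psi_hom)) => g j.
  by rewrite /= phi_f psi_gen.
have phiK : cancel psi phi.
  apply: (universal_id SU (star_hom_comp psi_hom phi_hom)) => g j.
  by rewrite /= psi_gen phi_f.
have [act_iso act0 actD] := @antipodal_actionP R d.
(* The action is the antipodal one transported along [phi], so equivariance is immediate, and its
   values on generators come from [antipodal_gen]. *)
pose alpha g := psi \o (@antipodal_action R d g \o phi).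
have alpha_hom g : star_hom (alpha g).
  by do 2![apply: star_hom_comp => //]; exact: (act_iso g).1.
have alpha0 : alpha 0 =1 id by move=> a; rewrite /alpha /= act0 psiK.
have alphaD g h : alpha (g + h) =1 alpha g \o alpha h.
  by move=> a; rewrite /alpha /= actD phiK.
have alpha_f g h j : alpha g (f h j) = f (g + h) j.
  by rewrite /alpha /= phi_f antipodal_gen psi_gen.
exists alpha; split.
- split=> //; split=> // g; split=> //.
  by exists (alpha (- g)) => a; rewrite -[LHS]alphaD ?addNr ?addrN alpha0.
- move=> beta [[beta_iso _ _] beta_f] g a.
  (* Two actions agreeing on generators agree: this composite fixes every generator. *)
  have h : alpha (- g) \o beta g =1 id.
    apply: (universal_id AU (star_hom_comp (beta_iso g).1 (alpha_hom _))) => h j.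
    by rewrite /= beta_f alpha_f addKr.
  by rewrite -[in RHS](h a) -[RHS]alphaD addrN alpha0.
- exists phi; split.
  + by split=> //; exists psi.
  + by move=> g a; rewrite /alpha /= phiK.
  + by move=> g j x; rewrite phi_f.
Qed.
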